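(* Let $m$ be a nonnegative integer, let $\beta$ be complex with $\Re(\beta)>\max(0,m-1)$, let $e$ be a real number with $e<1$, and let $a,c$ be real numbers such that $c-a(a+t)>0$, $c-(a+1)(a+t)>0$ and $c-(a+t)^2>0$ for all $t\in[0,1]$. Then \[ \frac{\Gamma(\beta)\Gamma(\beta)}{2\,\Gamma(2\beta)}=(c-(a+1)^2)\int_0^1 \frac{(c-a(a+t))^{\beta}\,(c-(a+1)(a+t))^{\beta-1}}{(c-(a+t)^2)^{2\beta}}\; {}_2F_1\!\left[\begin{matrix}-\beta,\ -m\\ -2\beta\end{matrix};\frac{c-(a+t)^2}{(c-a(a+t))(1-et)}\right]\left(\frac{1-et}{1-e}\right)^{m}t^{\beta-m}(1-t)^{\beta-1}\,dt . \]
   Context: Powers of positive reals are principal powers. ${}_2F_1\!\left[\begin{matrix}-\beta,-m\\ -2\beta\end{matrix};x\right]=\sum_{n=0}^{m}\frac{(-\beta)_n(-m)_n}{n!\,(-2\beta)_n}x^n$ (a polynomial in $x$), where $(x)_n=x(x+1)\cdots(x+n-1)$. *)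

(* Defs.v *)
From Stdlib Require Import Reals Factorial.
From Coquelicot Require Import Coquelicot.

Open Scope R_scope.

(* Principal power x^z of a positive real x with complex exponent z:
   x^z = exp(z ln x) = e^{Re z ln x} (cos (Im z ln x) + i sin (Im z ln x)). *)
Definition Rcpow (x : R) (z : C) : C :=
  (exp (Re z * ln x) * cos (Im z * ln x), exp (Re z * ln x) * sin (Im z * ln x)).

Definition CGamma (z : C) : C :=
  @RInt_gen C_R_CompleteNormedModule
    (fun t => Cmult (Rcpow t (Cminus z (RtoC 1))) (RtoC (exp (- t))))
    (at_right 0) (Rbar_locally p_infty).

Fixpoint poch (x : C) (n : nat) : C :=
  match n with
  | O => RtoC 1
  | S k => Cmult (poch x k) (Cplus x (RtoC (INR k)))
  end.

Fixpoint Csum (f : nat -> C) (N : nat) : C :=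
  match N with
  | O => f O
  | S k => Cplus (Csum f k) (f (S k))
  end.

Definition F21_special (b : C) (m : nat) (x : R) : C :=
  Csum (fun n =>
    Cdiv (Cmult (Cmult (poch (Copp b) n) (poch (RtoC (- INR m)) n)) (RtoC (x ^ n)))
         (Cmult (RtoC (INR (fact n))) (poch (Copp (Cmult (RtoC 2) b)) n))) m.

(* Main.v *)
Require Import Defs.
From Stdlib Require Import Reals.
From Coquelicot Require Import Coquelicot.
From Stdlib Require Import Factorial Lra Lia Psatz.
Open Scope R_scope.

(* Put P = c - a(a+t), Q = c - (a+1)(a+t), S = c - (a+t)^2, y = 1 - e and u = tQ/S. Writing
   1 - et = (1-t) + yt and expanding, the integrand becomes a sum over j <= m of y^(-j) times
   V_j(u) r^(j-1) / S, where r = (1-t)Q/S and V_j is proportional to the j-th derivative of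
   (u(1-u))^beta: the hypergeometric polynomial is a Jacobi polynomial in Rodrigues form.
   A Moebius involution t -> t' of (0,1) sends u to 1 - u and r to some r', and r, -r' are the
   roots of a quadratic whose coefficients are polynomials in u. Hence the sum of the j-th terms
   at t and t' is V_j(u) du times (r^(j-1) - (-r')^(j-1)) / (r + r'), up to a constant. For
   j >= 1 this quotient is a polynomial in u of degree < j, so the term integrates to 0 by parts;
   the j = 0 term is (u(1-u))^(beta-1) du / (c - (a+1)^2). Therefore twice the integral is
   B(beta,beta) / (c - (a+1)^2).
   The identity Gamma(z)^2 = B(z,z) Gamma(2z) holds because both sides are multiplied by z^2
   when z is replaced by z + 1 and they are asymptotic to each other along z + n; the same
   asymptotics show that Gamma has no zero with Re z > 0. *)

(** * Improper integrals *)

(** Origin of the involution: in s = a + t the zeros of S are sqrt c and - sqrt c, and t -> t' is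
    the Moebius involution in s that exchanges a with a + 1 and sqrt c with - sqrt c. Hence dt/S
    only changes sign, and P and Q are exchanged up to factors. The obstacle is that r alone is not
    a polynomial in u, so a single term with j >= 1 cannot be integrated by parts against V_j.
    Pairing t with t' leaves only symmetric functions of r and - r', which are polynomials in u. The
    condition Re beta > m - 1 makes t^(beta - m) integrable at 0 and kills the boundary terms of the
    integrations by parts, whose lowest exponent is beta - (m - 1). Together with Re beta > 0 it
    also keeps 2 beta away from 0, ..., m - 1. The parameter e enters only through y^(-j), and the
    terms with j >= 1 integrate to 0; therefore the left side is free of e. Functional equation and
    asymptotics replace the double integral usually behind Gamma(z)^2 = B(z,z) Gamma(2z), so that
    only integrals in one variable occur. *)

(** Treats (0,1) and (0,infinity) at once. The last field is the order of the end points that the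
    norm inequality for integrals asks for. *)
Record interval_ends (D : R -> Prop) (Fa Fb : (R -> Prop) -> Prop) : Prop := {
  ends_left : Fa D;
  ends_right : Fb D;
  ends_convex : forall x y z, D x -> D y -> x <= z <= y -> D z;
  ends_ordered : filter_prod Fa Fb (fun ab => fst ab <= snd ab) }.

Lemma ends_between D Fa Fb : interval_ends D Fa Fb ->
  forall x y z, D x -> D y -> Rmin x y <= z <= Rmax x y -> D z.
Proof.
  intros E x y z Dx Dy.
  destruct (Rle_dec x y) as [h|h].
  - rewrite Rmin_left, Rmax_right by lra. now apply (ends_convex _ _ _ E).
  - rewrite Rmin_right, Rmax_left by lra. now apply (ends_convex _ _ _ E).
Qed.

Lemma unit_ends : interval_ends (fun x => 0 < x < 1) (at_right 0) (at_left 1).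
Proof.
  split.
  - exists (mkposreal _ Rlt_0_1); intros y hy hy0.
    change (Rabs (y - 0) < 1) in hy. apply Rabs_def2 in hy. lra.
  - exists (mkposreal _ Rlt_0_1); intros y hy hy0.
    change (Rabs (y - 1) < 1) in hy. apply Rabs_def2 in hy. lra.
  - intros; lra.
  - assert (h : 0 < 1/2) by lra.
    exists (fun x => x < 1/2) (fun x => 1/2 < x).
    + exists (mkposreal _ h); intros y hy hy0.
      change (Rabs (y - 0) < 1/2) in hy. apply Rabs_def2 in hy. lra.
    + exists (mkposreal _ h); intros y hy hy0.
      change (Rabs (y - 1) < 1/2) in hy. apply Rabs_def2 in hy. lra.
    + simpl; intros; lra.
Qed.

Lemma half_line_ends :
  interval_ends (fun x => 0 < x) (at_right 0) (Rbar_locally p_infty).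
Proof.
  split.
  - exists (mkposreal _ Rlt_0_1); intros y hy hy0. exact hy0.
  - now exists 0.
  - intros; lra.
  - exists (fun x => x < 1) (fun x => 1 < x).
    + exists (mkposreal _ Rlt_0_1); intros y hy hy0.
      change (Rabs (y - 0) < 1) in hy. apply Rabs_def2 in hy. lra.
    + now exists 1.
    + simpl; intros; lra.
Qed.

Lemma ends_prod {D : R -> Prop} {Fa Fb : (R -> Prop) -> Prop}
  {FFa : ProperFilter Fa} {FFb : ProperFilter Fb} (E : interval_ends D Fa Fb)
  (P : R * R -> Prop) :
  (forall a b, D a -> D b -> P (a, b)) -> filter_prod Fa Fb P.
Proof.
  intros H. exists D D; [apply E | apply E | exact H].
Qed.

Lemma is_RInt_gen_ext_on {D : R -> Prop} {Fa Fb : (R -> Prop) -> Prop}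
  {FFa : ProperFilter Fa} {FFb : ProperFilter Fb} (E : interval_ends D Fa Fb)
  {V : NormedModule R_AbsRing} (f g : R -> V) l :
  (forall x, D x -> f x = g x) -> is_RInt_gen f Fa Fb l -> is_RInt_gen g Fa Fb l.
Proof.
  intros H. apply is_RInt_gen_ext. apply (ends_prod E). intros a b Da Db x hx.
  apply H. apply (ends_between _ _ _ E a b); auto. simpl in hx; lra.
Qed.

Lemma is_RInt_gen_unique_on {D : R -> Prop} {Fa Fb : (R -> Prop) -> Prop}
  {FFa : ProperFilter Fa} {FFb : ProperFilter Fb} (E : interval_ends D Fa Fb)
  {V : CompleteNormedModule R_AbsRing} (f : R -> V) l l' :
  is_RInt_gen f Fa Fb l -> is_RInt_gen f Fa Fb l' -> l = l'.
Proof.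
  intros h h'. rewrite <- (is_RInt_gen_unique _ _ h). now apply is_RInt_gen_unique.
Qed.

Lemma is_RInt_gen_antiderivative {D : R -> Prop} {Fa Fb : (R -> Prop) -> Prop}
  {FFa : ProperFilter Fa} {FFb : ProperFilter Fb} (E : interval_ends D Fa Fb)
  (F f : R -> R) la lb :
  (forall x, D x -> is_derive F x (f x)) -> (forall x, D x -> continuous f x) ->
  filterlim F Fa (locally la) -> filterlim F Fb (locally lb) ->
  is_RInt_gen f Fa Fb (lb - la).
Proof.
  intros HF Hf Hla Hlb P HP.
  assert (HQ : filter_prod Fa Fb (fun ab => P (F (snd ab) - F (fst ab)))).
  { assert (L : filterlim (fun ab : R * R => F (snd ab) - F (fst ab))
             (filter_prod Fa Fb) (locally (lb - la))).
    { apply (filterlim_comp_2 (F := filter_prod Fa Fb) (G := locally lb) (H := locally (opp la))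
        (fun ab => F (snd ab)) (fun ab => opp (F (fst ab))) plus).
      - eapply filterlim_comp; [apply filterlim_snd | exact Hlb].
      - eapply filterlim_comp; [| apply (filterlim_opp la)].
        eapply filterlim_comp; [apply filterlim_fst | exact Hla].
      - apply (filterlim_plus lb (opp la)). }
    exact (L P HP). }
  assert (HD := ends_prod E (fun ab => D (fst ab) /\ D (snd ab)) (fun a b Da Db => conj Da Db)).
  unfold filtermapi. generalize (filter_and _ _ HQ HD). apply filter_imp.
  intros [a b] [HPab [Da Db]]; simpl in *.
  exists (F b - F a). split; auto.
  apply (is_RInt_derive F f).
  - intros x hx. apply HF. now apply (ends_between _ _ _ E a b).
  - intros x hx. apply Hf. now apply (ends_between _ _ _ E a b).
Qed.

(** Absolute values stand on both sides because [a] and [b] come in either order when an end of the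
    interval moves. *)
Lemma Rabs_RInt_le {D : R -> Prop} {Fa Fb : (R -> Prop) -> Prop}
  {FFa : ProperFilter Fa} {FFb : ProperFilter Fb} (E : interval_ends D Fa Fb)
  (f g : R -> R) a b : D a -> D b ->
  (forall x, D x -> continuous f x) -> (forall x, D x -> continuous g x) ->
  (forall x, D x -> Rabs (f x) <= g x) ->
  Rabs (RInt f a b) <= Rabs (RInt g a b).
Proof.
  intros Da Db Hf Hg H.
  assert (W : forall a b, D a -> D b -> a <= b -> Rabs (RInt f a b) <= Rabs (RInt g a b)).
  { clear a b Da Db. intros a b Da Db hab.
    assert (ef : ex_RInt f a b).
    { apply (ex_RInt_continuous (V := R_CompleteNormedModule)). intros z hz. apply Hf.
      now apply (ends_between _ _ _ E a b). }
    assert (eg : ex_RInt g a b).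
    { apply (ex_RInt_continuous (V := R_CompleteNormedModule)). intros z hz. apply Hg.
      now apply (ends_between _ _ _ E a b). }
    eapply Rle_trans; [|apply Rle_abs].
    apply (norm_RInt_le f g a b); auto.
    - intros x hx. apply H. apply (ends_convex _ _ _ E a b); auto.
    - now apply (RInt_correct (V := R_CompleteNormedModule)).
    - now apply (RInt_correct (V := R_CompleteNormedModule)). }
  destruct (Rle_dec a b) as [h|h]; [now apply W|].
  assert (S : forall k : R -> R, (forall x, D x -> continuous k x) ->
     RInt k a b = - RInt k b a).
  { intros k Hk. symmetry. apply (opp_RInt_swap (V := R_CompleteNormedModule)).
    apply (ex_RInt_continuous (V := R_CompleteNormedModule)). intros z hz. apply Hk.
    now apply (ends_between _ _ _ E b a). }
  rewrite (S f), (S g), !Rabs_Ropp; auto. apply W; auto; lra.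
Qed.

(** Cauchy criterion: moving one end changes the integral of [f] by at most the change in the
    integral of [g], which is small because [g] is integrable. *)
Lemma ex_RInt_gen_dominated {D : R -> Prop} {Fa Fb : (R -> Prop) -> Prop}
  {FFa : ProperFilter Fa} {FFb : ProperFilter Fb} (E : interval_ends D Fa Fb)
  (f g : R -> R) Ig :
  (forall x, D x -> continuous f x) -> (forall x, D x -> continuous g x) ->
  (forall x, D x -> Rabs (f x) <= g x) ->
  is_RInt_gen g Fa Fb Ig -> exists I, is_RInt_gen f Fa Fb I.
Proof.
  intros Hf Hg H HI.
  assert (ex : forall k : R -> R, (forall x, D x -> continuous k x) ->
     forall a b, D a -> D b -> is_RInt k a b (RInt k a b)).
  { intros k Hk a b Da Db. apply (RInt_correct (V := R_CompleteNormedModule)).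
    apply (ex_RInt_continuous (V := R_CompleteNormedModule)). intros z hz. apply Hk.
    now apply (ends_between _ _ _ E a b). }
  assert (Ch : forall k : R -> R, (forall x, D x -> continuous k x) ->
     forall a b c, D a -> D b -> D c -> RInt k a c = RInt k a b + RInt k b c).
  { intros k Hk a b c Da Db Dc. symmetry.
    apply (RInt_Chasles (V := R_CompleteNormedModule) k a b c).
    - eexists; now apply ex.
    - eexists; now apply ex. }
  assert (Hu : forall k : R -> R, (forall x, D x -> continuous k x) ->
     filter_prod Fa Fb (fun ab => (exists y : R, is_RInt k (fst ab) (snd ab) y) /\
       (forall y1 y2 : R, is_RInt k (fst ab) (snd ab) y1 -> is_RInt k (fst ab)
         (snd ab) y2 -> y1 = y2))).
  { intros k Hk. apply (ends_prod E). intros a b Da Db; simpl. split.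
    - eexists; now apply ex.
    - intros y1 y2 h1 h2. rewrite <- (is_RInt_unique _ _ _ _ h1). now apply is_RInt_unique. }
  apply (proj1 (filterlimi_locally_cauchy (U := R_CompleteSpace) (F := filter_prod Fa Fb) _ (Hu f Hf))).
  intros eps.
  assert (hg := proj2 (filterlimi_locally_cauchy (U := R_CompleteSpace) (F := filter_prod Fa Fb) _
    (Hu g Hg))
    (ex_intro _ Ig HI) (pos_div_2 eps)).
  destruct hg as [P [[Q1 Q2 hQ1 hQ2 hQ] hP]].
  exists (fun ab => (Q1 (fst ab) /\ D (fst ab)) /\ (Q2 (snd ab) /\ D (snd ab))). split.
  { exists (fun x => Q1 x /\ D x) (fun x => Q2 x /\ D x).
    - apply filter_and; auto; apply E.
    - apply filter_and; auto; apply E.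
    - simpl; auto. }
  intros [a b] [a' b']; simpl. intros [[qa Da] [qb Db]] [[qa' Da'] [qb' Db']] u' v' hu hv.
  (* The ends are moved one at a time, through the interval from [a'] to [b], each at a cost of
     [eps / 2]. *)
  assert (B1 : Rabs (RInt g a' b - RInt g a b) < eps / 2).
  { apply (hP (a, b) (a', b)); auto; simpl; auto; now apply ex. }
  assert (B2 : Rabs (RInt g a' b' - RInt g a' b) < eps / 2).
  { apply (hP (a', b) (a', b')); auto; simpl; auto; now apply ex. }
  assert (eu : u' = RInt f a b) by (symmetry; now apply is_RInt_unique).
  assert (ev : v' = RInt f a' b') by (symmetry; now apply is_RInt_unique).
  change (Rabs (v' - u') < eps). subst.
  rewrite (Ch g Hg a a' b), (Ch g Hg a' b b') in * by auto.
  rewrite (Ch f Hf a a' b), (Ch f Hf a' b b') by auto.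
  assert (C1 := Rabs_RInt_le E f g a a' Da Da' Hf Hg H).
  assert (C2 := Rabs_RInt_le E f g b b' Db Db' Hf Hg H).
  assert (R3 : forall fa fb fm ga gb gm e : R, Rabs (gm - (ga + gm)) < e / 2 ->
    Rabs (gm + gb - gm) < e / 2 -> Rabs fa <= Rabs ga -> Rabs fb <= Rabs gb ->
    Rabs (fm + fb - (fa + fm)) < e).
  { clear. intros fa fb fm ga gb gm e.
    replace (gm - (ga + gm)) with (- ga) by ring.
    replace (gm + gb - gm) with gb by ring.
    replace (fm + fb - (fa + fm)) with (fb - fa) by ring.
    rewrite Rabs_Ropp. intros. assert (T := Rabs_triang fb (- fa)).
    rewrite Rabs_Ropp in T. unfold Rminus. lra. }
  exact (R3 _ _ _ _ _ _ _ B1 B2 C1 C2).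
Qed.

Lemma is_RInt_gen_pair {Fa Fb} {FFa : Filter Fa} {FFb : Filter Fb} (f : R -> C) (l : C) :
  is_RInt_gen f Fa Fb l <->
  is_RInt_gen (fun t => fst (f t)) Fa Fb (fst l) /\ is_RInt_gen (fun t => snd (f t)) Fa Fb (snd l).
Proof.
  split.
  - intros h; split; intros P [eps HP].
    + assert (L : locally l (fun z : C => P (fst z))).
      { exists eps. intros z [hz _]. now apply HP. }
      generalize (h _ L). unfold filtermapi. apply filter_imp. intros ab [y [hy hp]].
      exists (fst y). split; auto.
      now apply (is_RInt_fct_extend_fst f).
    + assert (L : locally l (fun z : C => P (snd z))).
      { exists eps. intros z [_ hz]. now apply HP. }
      generalize (h _ L). unfold filtermapi. apply filter_imp. intros ab [y [hy hp]].
      exists (snd y). split; auto.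
      now apply (is_RInt_fct_extend_snd f).
  - intros [h1 h2] P [eps HP].
    assert (b1 := h1 _ (locally_ball (fst l) eps)).
    assert (b2 := h2 _ (locally_ball (snd l) eps)).
    unfold filtermapi in *. generalize (filter_and _ _ b1 b2). apply filter_imp.
    intros ab [[y1 [i1 c1]] [y2 [i2 c2]]]. exists (y1, y2). split.
    + now apply is_RInt_fct_extend_pair.
    + apply HP. now split.
Qed.

Lemma is_RInt_gen_Cmult {Fa Fb} {FFa : Filter Fa} {FFb : Filter Fb} (f : R -> C) (k l : C) :
  is_RInt_gen f Fa Fb l -> is_RInt_gen (fun t => Cmult k (f t)) Fa Fb (Cmult k l).
Proof.
  rewrite !is_RInt_gen_pair. intros [h1 h2]; split; simpl.
  - apply (is_RInt_gen_minus (fun t => fst k * fst (f t)) (fun t => snd k * snd (f t)));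
      now apply (is_RInt_gen_scal (V := R_NormedModule)).
  - apply (is_RInt_gen_plus (fun t => fst k * snd (f t)) (fun t => snd k * fst (f t)));
      now apply (is_RInt_gen_scal (V := R_NormedModule)).
Qed.

Lemma is_RInt_gen_Cplus {Fa Fb} {FFa : Filter Fa} {FFb : Filter Fb} (f g : R -> C) (l l' : C) :
  is_RInt_gen f Fa Fb l -> is_RInt_gen g Fa Fb l' ->
  is_RInt_gen (fun t => Cplus (f t) (g t)) Fa Fb (Cplus l l').
Proof. exact (is_RInt_gen_plus f g l l'). Qed.

Lemma is_RInt_gen_RtoC {Fa Fb} {FFa : Filter Fa} {FFb : Filter Fb} (f : R -> R) l :
  is_RInt_gen f Fa Fb l -> is_RInt_gen (fun t => RtoC (f t)) Fa Fb (RtoC l).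
Proof.
  intros h. apply is_RInt_gen_pair; split; simpl; auto.
  assert (k := is_RInt_gen_scal (V := R_NormedModule) f 0 l h).
  change (is_RInt_gen (fun y => 0 * f y) Fa Fb (0 * l)) in k. rewrite Rmult_0_l in k.
  revert k. apply is_RInt_gen_ext. apply filter_forall. intros; apply Rmult_0_l.
Qed.

(** No monotonicity of [s] is asked: on compact subintervals the rule holds for every C^1 map, and
    beyond that only the limits of [s] at the two ends matter. In particular [s] may exchange the
    ends. *)
Lemma is_RInt_gen_subst {D D' : R -> Prop} {Fa Fb Fa' Fb' : (R -> Prop) -> Prop}
  {FFa : ProperFilter Fa} {FFb : ProperFilter Fb} (E : interval_ends D Fa Fb)
  {V : CompleteNormedModule R_AbsRing} (f : R -> V) (s ds : R -> R) l :
  (forall x, D x -> D' (s x)) -> (forall x, D' x -> continuous f x) ->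
  (forall x, D x -> is_derive s x (ds x)) -> (forall x, D x -> continuous ds x) ->
  filterlim s Fa Fa' -> filterlim s Fb Fb' ->
  is_RInt_gen f Fa' Fb' l ->
  is_RInt_gen (fun t => scal (ds t) (f (s t))) Fa Fb l.
Proof.
  intros Hs Hf Hd Hc La Lb HI P HP.
  destruct (HI P HP) as [Q1 Q2 hQ1 hQ2 hQ].
  exists (fun x => Q1 (s x) /\ D x) (fun x => Q2 (s x) /\ D x).
  - apply filter_and; [exact (La _ hQ1) | apply E].
  - apply filter_and; [exact (Lb _ hQ2) | apply E].
  - intros a b [qa Da] [qb Db]. destruct (hQ _ _ qa qb) as [y [hy py]]. simpl in hy.
    exists y; split; auto. simpl. rewrite <- (is_RInt_unique _ _ _ _ hy).
    apply is_RInt_comp.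
    + intros x hx. apply Hf, Hs. now apply (ends_between _ _ _ E a b).
    + intros x hx. assert (Dx := ends_between _ _ _ E a b x Da Db hx). auto.
Qed.

(** * Complex-valued functions of a real variable *)

Lemma C_ext (z w : C) : fst z = fst w -> snd z = snd w -> z = w.
Proof. destruct z, w; simpl; intros; subst; auto. Qed.

Lemma filterlim_C {T} {F : (T -> Prop) -> Prop} {FF : Filter F} (f : T -> C) (l : C) :
  filterlim f F (locally l) <->
  filterlim (fun t => fst (f t)) F (locally (fst l)) /\
  filterlim (fun t => snd (f t)) F (locally (snd l)).
Proof.
  split.
  - intros h; split; intros P [eps HP].
    + apply (h (fun z : C => P (fst z))). exists eps; intros z [hz1 hz2]; now apply HP.
    + apply (h (fun z : C => P (snd z))). exists eps; intros z [hz1 hz2]; now apply HP.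
  - intros [h1 h2] P [eps HP].
    assert (c1 := h1 _ (locally_ball (fst l) eps)).
    assert (c2 := h2 _ (locally_ball (snd l) eps)).
    unfold filtermap in *. generalize (filter_and _ _ c1 c2). apply filter_imp.
    intros x [b1 b2]. apply HP. now split.
Qed.

Lemma filterlim_Rmult {T} {F : (T -> Prop) -> Prop} {FF : Filter F} (f g : T -> R) a b :
  filterlim f F (locally a) -> filterlim g F (locally b) ->
  filterlim (fun t => f t * g t) F (locally (a * b)).
Proof.
  intros hf hg. apply (filterlim_comp_2 f g Rmult hf hg (filterlim_mult (K := R_AbsRing) a b)).
Qed.

Lemma filterlim_Rplus {T} {F : (T -> Prop) -> Prop} {FF : Filter F} (f g : T -> R) a b :
  filterlim f F (locally a) -> filterlim g F (locally b) ->
  filterlim (fun t => f t + g t) F (locally (a + b)).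
Proof.
  intros hf hg.
  apply (filterlim_comp_2 f g Rplus hf hg (filterlim_plus (V := R_NormedModule) a b)).
Qed.

Lemma filterlim_Ropp {T} {F : (T -> Prop) -> Prop} {FF : Filter F} (f : T -> R) a :
  filterlim f F (locally a) -> filterlim (fun t => - f t) F (locally (- a)).
Proof.
  intros hf. apply (filterlim_comp _ _ _ f Ropp _ _ _ hf (filterlim_opp (V := R_NormedModule) a)).
Qed.

Lemma filterlim_Cmult {T} {F : (T -> Prop) -> Prop} {FF : Filter F} (f g : T -> C) (a b : C) :
  filterlim f F (locally a) -> filterlim g F (locally b) ->
  filterlim (fun t => Cmult (f t) (g t)) F (locally (Cmult a b)).
Proof.
  rewrite !filterlim_C. intros [f1 f2] [g1 g2]. split; simpl.
  - apply (filterlim_Rplus (fun t => fst (f t) * fst (g t)) (fun t => - (snd (f t) * snd (g t)))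
      (fst a * fst b) (- (snd a * snd b))).
    + now apply filterlim_Rmult.
    + now apply filterlim_Ropp, filterlim_Rmult.
  - apply filterlim_Rplus; now apply filterlim_Rmult.
Qed.

Lemma filterlim_Cplus {T} {F : (T -> Prop) -> Prop} {FF : Filter F} (f g : T -> C) (a b : C) :
  filterlim f F (locally a) -> filterlim g F (locally b) ->
  filterlim (fun t => Cplus (f t) (g t)) F (locally (Cplus a b)).
Proof.
  rewrite !filterlim_C. intros [f1 f2] [g1 g2]. split; simpl; now apply filterlim_Rplus.
Qed.

Lemma filterlim_RtoC {T} {F : (T -> Prop) -> Prop} {FF : Filter F} (f : T -> R) a :
  filterlim f F (locally a) -> filterlim (fun t => RtoC (f t)) F (locally (RtoC a)).
Proof. intros h. apply filterlim_C; split; simpl; auto. apply filterlim_const. Qed.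

Lemma filterlim_C_zero {T} {F : (T -> Prop) -> Prop} {FF : Filter F} (f : T -> C) (g : T -> R) :
  F (fun t => Cmod (f t) <= g t) -> filterlim g F (locally 0) ->
  filterlim f F (locally (RtoC 0)).
Proof.
  intros H hg. apply filterlim_C.
  assert (W : forall k : C -> R, (forall z, Rabs (k z) <= Cmod z) ->
     filterlim (fun t => k (f t)) F (locally 0)).
  { intros k hk P [eps HP]. unfold filtermap.
    assert (c := hg _ (locally_ball 0 eps)). unfold filtermap in *.
    generalize (filter_and _ _ H c). apply filter_imp.
    intros t [h1 h2]. apply HP. change (Rabs (g t - 0) < eps) in h2.
    change (Rabs (k (f t) - 0) < eps). rewrite Rminus_0_r in *.
    assert (h3 := hk (f t)). assert (h4 := Rle_abs (g t)). lra. }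
  split; simpl; apply W; intros z; eapply Rle_trans; [|apply Rmax_Cmod| |apply Rmax_Cmod].
  - apply Rmax_l.
  - apply Rmax_r.
Qed.

(** Componentwise, so that the real rules and [auto_derive] apply to each part. *)
Definition is_Cderive (f : R -> C) (x : R) (l : C) : Prop :=
  is_derive (fun t => fst (f t)) x (fst l) /\ is_derive (fun t => snd (f t)) x (snd l).

Lemma is_Cderive_const k x : is_Cderive (fun _ => k) x (RtoC 0).
Proof. split; simpl; apply (is_derive_const (V := R_NormedModule)). Qed.

Lemma is_Cderive_RtoC f x l : is_derive f x l -> is_Cderive (fun t => RtoC (f t)) x (RtoC l).
Proof. intros h; split; simpl; auto. apply (is_derive_const (V := R_NormedModule)). Qed.

Lemma is_Cderive_plus f g x a b : is_Cderive f x a -> is_Cderive g x b ->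
  is_Cderive (fun t => Cplus (f t) (g t)) x (Cplus a b).
Proof.
  intros [f1 f2] [g1 g2]; split; simpl; now apply (is_derive_plus (V := R_NormedModule)).
Qed.

Lemma is_Cderive_mult f g x a b : is_Cderive f x a -> is_Cderive g x b ->
  is_Cderive (fun t => Cmult (f t) (g t)) x (Cplus (Cmult a (g x)) (Cmult (f x) b)).
Proof.
  assert (M : forall (f g : R -> R) a b, is_derive f x a -> is_derive g x b ->
    is_derive (fun t => f t * g t) x (a * g x + f x * b)).
  { intros. apply (is_derive_mult f0 g0 x a0 b0); auto. intros; apply Rmult_comm. }
  intros [f1 f2] [g1 g2]; split; simpl.
  - replace (_ + _) with ((fst a * fst (g x) + fst (f x) * fst b) -
      (snd a * snd (g x) + snd (f x) * snd b)) by ring.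
    apply (is_derive_minus (V := R_NormedModule) (fun t => fst (f t) * fst (g t))
      (fun t => snd (f t) * snd (g t))); now apply M.
  - replace (_ + _) with ((fst a * snd (g x) + fst (f x) * snd b) +
      (snd a * fst (g x) + snd (f x) * fst b)) by ring.
    apply (is_derive_plus (V := R_NormedModule) (fun t => fst (f t) * snd (g t))
      (fun t => snd (f t) * fst (g t))); now apply M.
Qed.

Lemma is_Cderive_comp f (s : R -> R) x a b : is_Cderive f (s x) a -> is_derive s x b ->
  is_Cderive (fun t => f (s t)) x (Cmult (RtoC b) a).
Proof.
  intros [f1 f2] hs; split; simpl.
  - replace (b * fst a - 0 * snd a) with (b * fst a) by ring.
    apply (is_derive_comp (fun t => fst (f t)) s x (fst a) b); auto.
  - replace (b * snd a + 0 * fst a) with (b * snd a) by ring.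
    apply (is_derive_comp (fun t => snd (f t)) s x (snd a) b); auto.
Qed.

Lemma is_Cderive_unique f x a b : is_Cderive f x a -> is_Cderive f x b -> a = b.
Proof.
  intros [a1 a2] [b1 b2]. apply C_ext.
  - rewrite <- (is_derive_unique _ _ _ a1). now apply is_derive_unique.
  - rewrite <- (is_derive_unique _ _ _ a2). now apply is_derive_unique.
Qed.

Lemma is_Cderive_ext_loc f g x a : locally x (fun t => f t = g t) ->
  is_Cderive f x a -> is_Cderive g x a.
Proof.
  intros h [a1 a2]; split.
  - eapply is_derive_ext_loc; [|exact a1]. revert h. apply filter_imp. intros t e; now rewrite e.
  - eapply is_derive_ext_loc; [|exact a2]. revert h. apply filter_imp. intros t e; now rewrite e.
Qed.

Lemma is_Cderive_continuous f x a : is_Cderive f x a -> continuous f x.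
Proof.
  intros [a1 a2]. apply filterlim_C. split.
  - apply (ex_derive_continuous (V := R_NormedModule) (fun t => fst (f t))). now exists (fst a).
  - apply (ex_derive_continuous (V := R_NormedModule) (fun t => snd (f t))). now exists (snd a).
Qed.

Lemma continuous_C (f : R -> C) x : continuous f x <->
  continuous (fun t => fst (f t)) x /\ continuous (fun t => snd (f t)) x.
Proof. apply filterlim_C. Qed.

Lemma continuous_Cmult (f g : R -> C) x : continuous f x -> continuous g x ->
  continuous (fun t => Cmult (f t) (g t)) x.
Proof. apply filterlim_Cmult. Qed.

Lemma continuous_Cplus (f g : R -> C) x : continuous f x -> continuous g x ->
  continuous (fun t => Cplus (f t) (g t)) x.
Proof. apply filterlim_Cplus. Qed.

Lemma continuous_RtoC (f : R -> R) x : continuous f x -> continuous (fun t => RtoC (f t)) x.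
Proof. apply filterlim_RtoC. Qed.

Lemma is_RInt_gen_Cantiderivative {D : R -> Prop} {Fa Fb : (R -> Prop) -> Prop}
  {FFa : ProperFilter Fa} {FFb : ProperFilter Fb} (E : interval_ends D Fa Fb)
  (F f : R -> C) (la lb : C) :
  (forall x, D x -> is_Cderive F x (f x)) -> (forall x, D x -> continuous f x) ->
  filterlim F Fa (locally la) -> filterlim F Fb (locally lb) ->
  is_RInt_gen f Fa Fb (Cminus lb la).
Proof.
  intros HF Hf. rewrite !filterlim_C. intros [a1 a2] [b1 b2].
  apply is_RInt_gen_pair; split; simpl.
  - apply (is_RInt_gen_antiderivative E (fun t => fst (F t)) (fun t => fst (f t))); auto.
    + intros x Dx; now apply HF.
    + intros x Dx. exact (proj1 (proj1 (continuous_C f x) (Hf x Dx))).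
  - apply (is_RInt_gen_antiderivative E (fun t => snd (F t)) (fun t => snd (f t))); auto.
    + intros x Dx; now apply HF.
    + intros x Dx. exact (proj2 (proj1 (continuous_C f x) (Hf x Dx))).
Qed.

Lemma ex_RInt_gen_Cdominated {D : R -> Prop} {Fa Fb : (R -> Prop) -> Prop}
  {FFa : ProperFilter Fa} {FFb : ProperFilter Fb} (E : interval_ends D Fa Fb)
  (f : R -> C) (g : R -> R) Ig :
  (forall x, D x -> continuous f x) -> (forall x, D x -> continuous g x) ->
  (forall x, D x -> Cmod (f x) <= g x) ->
  is_RInt_gen g Fa Fb Ig -> exists I : C, is_RInt_gen f Fa Fb I.
Proof.
  intros Hf Hg H HI.
  destruct (ex_RInt_gen_dominated E (fun t => fst (f t)) g Ig) as [I1 h1]; auto.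
  { intros x Dx. exact (proj1 (proj1 (continuous_C f x) (Hf x Dx))). }
  { intros x Dx. eapply Rle_trans; [|apply H, Dx]. eapply Rle_trans; [|apply Rmax_Cmod]. apply Rmax_l. }
  destruct (ex_RInt_gen_dominated E (fun t => snd (f t)) g Ig) as [I2 h2]; auto.
  { intros x Dx. exact (proj2 (proj1 (continuous_C f x) (Hf x Dx))). }
  { intros x Dx. eapply Rle_trans; [|apply H, Dx]. eapply Rle_trans; [|apply Rmax_Cmod]. apply Rmax_r. }
  exists (I1, I2). now apply is_RInt_gen_pair.
Qed.

Lemma Cmod_RInt_gen_le {D : R -> Prop} {Fa Fb : (R -> Prop) -> Prop}
  {FFa : ProperFilter Fa} {FFb : ProperFilter Fb} (E : interval_ends D Fa Fb)
  (f : R -> C) (g : R -> R) (I : C) Ig :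
  (forall x, D x -> Cmod (f x) <= g x) ->
  is_RInt_gen f Fa Fb I -> is_RInt_gen g Fa Fb Ig -> Cmod I <= Ig.
Proof.
  intros H hf hg. rewrite Cmod_norm.
  apply (RInt_gen_norm (V := C_R_CompleteNormedModule) (Fa := Fa) (Fb := Fb) f g); auto.
  - apply E.
  - apply (ends_prod E). intros a b Da Db x hx. rewrite <- Cmod_norm. apply H.
    now apply (ends_convex _ _ _ E a b).
Qed.

(** * Principal powers of positive reals *)

Lemma Rcpow_plus x z w : Rcpow x (Cplus z w) = Cmult (Rcpow x z) (Rcpow x w).
Proof.
  unfold Rcpow. apply C_ext; simpl; unfold Re, Im;
    rewrite !Rmult_plus_distr_r, exp_plus, ?cos_plus, ?sin_plus; ring.
Qed.

Lemma Rcpow_mult x y z : 0 < x -> 0 < y -> Rcpow (x * y) z = Cmult (Rcpow x z) (Rcpow y z).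
Proof.
  intros hx hy. unfold Rcpow. rewrite ln_mult by auto.
  apply C_ext; simpl; rewrite !Rmult_plus_distr_l, exp_plus, ?cos_plus, ?sin_plus; ring.
Qed.

Lemma Rcpow_0 x : Rcpow x (RtoC 0) = RtoC 1.
Proof.
  unfold Rcpow; apply C_ext; simpl; rewrite ?Rmult_0_l, ?exp_0, ?cos_0, ?sin_0; ring.
Qed.

Lemma Rcpow_1 x : 0 < x -> Rcpow x (RtoC 1) = RtoC x.
Proof.
  intros hx. unfold Rcpow; apply C_ext; simpl;
    rewrite ?Rmult_0_l, ?Rmult_1_l, ?cos_0, ?sin_0, ?(exp_ln x hx); ring.
Qed.

Lemma Rcpow_base_1 z : Rcpow 1 z = RtoC 1.
Proof.
  unfold Rcpow; rewrite ln_1; apply C_ext; simpl;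
    rewrite ?Rmult_0_r, ?exp_0, ?cos_0, ?sin_0; ring.
Qed.

Lemma Rcpow_nat x n : 0 < x -> Rcpow x (RtoC (INR n)) = RtoC (x ^ n).
Proof.
  intros hx. induction n as [|n IH]; [apply Rcpow_0|].
  rewrite S_INR, RtoC_plus, Rcpow_plus, IH, Rcpow_1, <- RtoC_mult by auto.
  f_equal. simpl; ring.
Qed.

Lemma Cmod_Rcpow x z : Cmod (Rcpow x z) = exp (Re z * ln x).
Proof.
  unfold Cmod, Rcpow; simpl.
  match goal with |- sqrt ?u = _ => replace u with (Rsqr (exp (Re z * ln x))) end.
  - apply sqrt_Rsqr. left; apply exp_pos.
  - assert (h := sin2_cos2 (Im z * ln x)). unfold Rsqr in *.
    transitivity (exp (Re z * ln x) * exp (Re z * ln x) *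
      (sin (Im z * ln x) * sin (Im z * ln x) + cos (Im z * ln x) * cos (Im z * ln x)));
      [rewrite h; ring | ring].
Qed.

Lemma Rcpow_neq_0 x z : Rcpow x z <> RtoC 0.
Proof.
  intros h. assert (k := Cmod_Rcpow x z). rewrite h, Cmod_0 in k.
  assert (p := exp_pos (Re z * ln x)). lra.
Qed.

Lemma Rcpow_opp x z : Rcpow x (Copp z) = Cinv (Rcpow x z).
Proof.
  assert (h : Cmult (Rcpow x (Copp z)) (Rcpow x z) = RtoC 1).
  { rewrite <- Rcpow_plus, <- (Rcpow_0 x). f_equal. ring. }
  assert (n := Rcpow_neq_0 x z).
  transitivity (Cmult (Cmult (Rcpow x (Copp z)) (Rcpow x z)) (Cinv (Rcpow x z))).
  - field; auto.
  - rewrite h; field; auto.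
Qed.

Lemma is_Cderive_Rcpow x z : 0 < x ->
  is_Cderive (fun t => Rcpow t z) x (Cmult z (Rcpow x (Cminus z (RtoC 1)))).
Proof.
  intros hx. unfold Cminus.
  assert (e : Rcpow x (Copp (RtoC 1)) = RtoC (/ x)).
  { rewrite Rcpow_opp, Rcpow_1, RtoC_inv; auto; lra. }
  rewrite Rcpow_plus, e. unfold Rcpow. split; simpl.
  - auto_derive; auto. unfold Re, Im. field. lra.
  - auto_derive; auto. unfold Re, Im. field. lra.
Qed.

Lemma continuous_Rcpow x z : 0 < x -> continuous (fun t => Rcpow t z) x.
Proof. intros hx. eapply is_Cderive_continuous, is_Cderive_Rcpow, hx. Qed.

Lemma filterlim_exp_ln_0 a : 0 < a -> filterlim (fun t => exp (a * ln t)) (at_right 0) (locally 0).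
Proof.
  intros ha P [eps HP].
  assert (hd : 0 < exp (ln eps / a)) by apply exp_pos.
  exists (mkposreal _ hd). intros t ht ht0. apply HP.
  change (Rabs (t - 0) < exp (ln eps / a)) in ht. rewrite Rminus_0_r, Rabs_pos_eq in ht by lra.
  change (Rabs (exp (a * ln t) - 0) < eps).
  rewrite Rminus_0_r, Rabs_pos_eq by (left; apply exp_pos).
  destruct eps as [e he]; simpl in *.
  apply Rlt_le_trans with (exp (ln e)); [|rewrite exp_ln; lra].
  apply exp_increasing.
  assert (h := ln_increasing t _ ht0 ht). rewrite ln_exp in h.
  apply (Rmult_lt_compat_l a) in h; auto. field_simplify in h; lra.
Qed.

(** * The Gamma function *)

Lemma ln_le_sub_1 x : 0 < x -> ln x <= x - 1.
Proof. intros hx. assert (h := exp_ineq1_le (ln x)). rewrite exp_ln in h; lra. Qed.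

Lemma exp_le_compat x y : x <= y -> exp x <= exp y.
Proof. intros [h|h]; [left; now apply exp_increasing | rewrite h; lra]. Qed.

(** Tangent inequality for ln at [1 + t = a]; the constant a^a e^(1-a) is the maximum of (1+t)^a
    e^(-t) over t > -1. *)
Lemma power_exp_bounded a : 0 < a ->
  exists M, 0 < M /\ forall t, 0 < t -> exp (a * ln (1 + t) - t) <= M.
Proof.
  intros ha. exists (exp (1 - a + a * ln a)). split; [apply exp_pos|].
  intros t ht.
  assert (h : ln (1 + t) <= (1 + t) / a - 1 + ln a).
  { replace (1 + t) with ((1 + t) / a * a) at 1 by (field; lra).
    assert (0 < (1 + t) / a) by (apply Rdiv_lt_0_compat; lra).
    rewrite ln_mult by auto. assert (k := ln_le_sub_1 ((1 + t) / a) H). lra. }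
  apply (Rmult_le_compat_l a) in h; [|lra].
  replace (a * ((1 + t) / a - 1 + ln a)) with (1 + t - a + a * ln a) in h by (field; lra).
  apply exp_le_compat. lra.
Qed.

(** Supplies an integrable majorant for the Gamma integrand that has an elementary primitive,
    (t/(1+t))^x / x. *)
Lemma is_RInt_gen_power_quotient x : 0 < x ->
  is_RInt_gen (fun t => exp ((x - 1) * ln t - (x + 1) * ln (1 + t)))
    (at_right 0) (Rbar_locally p_infty) (/ x).
Proof.
  intros hx. replace (/ x) with (/ x - 0) by ring.
  apply (is_RInt_gen_antiderivative half_line_ends
    (fun t => / x * exp (x * (ln t - ln (1 + t))))).
  - intros t ht. auto_derive; [lra|].
    replace ((x - 1) * ln t - (x + 1) * ln (1 + t)) with
      (x * (ln t - ln (1 + t)) + (- ln t + - ln (1 + t))) by ring.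
    rewrite exp_plus, (exp_plus (- ln t)), !exp_Ropp, !exp_ln by lra.
    unfold Rminus. field. lra.
  - intros t ht. apply (ex_derive_continuous (V := R_NormedModule)).
    auto_derive. lra.
  - intros P [eps HP].
    assert (L := filterlim_exp_ln_0 x hx).
    assert (he : 0 < x * eps) by (apply Rmult_lt_0_compat; [auto|apply eps]).
    assert (L' := L _ (locally_ball 0 (mkposreal _ he))). unfold filtermap in *.
    generalize (filter_and _ _ L' (ends_left _ _ _ half_line_ends)). apply filter_imp.
    intros t [h1 ht]. apply HP.
    change (Rabs (exp (x * ln t) - 0) < x * eps) in h1.
    change (Rabs (/ x * exp (x * (ln t - ln (1 + t))) - 0) < eps).
    rewrite Rminus_0_r in *. rewrite Rabs_pos_eq in h1 by (left; apply exp_pos).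
    assert (0 < / x) by now apply Rinv_0_lt_compat.
    rewrite Rabs_pos_eq by (apply Rmult_le_pos; [lra|left; apply exp_pos]).
    apply Rle_lt_trans with (/ x * exp (x * ln t)).
    + apply Rmult_le_compat_l; [lra|]. left. apply exp_increasing.
      assert (0 < ln (1 + t)) by (rewrite <- ln_1; apply ln_increasing; lra).
      nra.
    + apply Rmult_lt_reg_l with x; auto. rewrite <- Rmult_assoc, Rinv_r, Rmult_1_l by lra. auto.
  - assert (L : filterlim (fun t => ln t - ln (1 + t)) (Rbar_locally p_infty) (locally 0)).
    { intros P [eps HP]. exists (/ eps). intros t ht. apply HP.
      assert (pe := cond_pos eps).
      assert (0 < / eps) by (apply Rinv_0_lt_compat, eps).
      change (Rabs (ln t - ln (1 + t) - 0) < eps).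
      assert (h : ln (1 + t) - ln t <= / t).
      { replace (1 + t) with ((1 + / t) * t) by (field; lra).
        assert (0 < / t) by (apply Rinv_0_lt_compat; lra).
        rewrite ln_mult by lra. assert (k := ln_le_sub_1 (1 + / t)). lra. }
      assert (ln t < ln (1 + t)) by (apply ln_increasing; lra).
      rewrite Rabs_left by lra.
      assert (/ t < eps).
      { rewrite <- (Rinv_inv eps). apply Rinv_lt_contravar; [|lra].
        apply Rmult_lt_0_compat; lra. }
      lra. }
    replace (locally (/ x)) with (locally (/ x * exp (x * 0))) by
      (f_equal; rewrite Rmult_0_r, exp_0; ring).
    apply (filterlim_comp _ _ _ (fun t => ln t - ln (1 + t)) (fun s => / x * exp (x * s)) _ _ _ L).
    apply (ex_derive_continuous (V := R_NormedModule) (fun s => / x * exp (x * s))).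
    auto_derive; auto.
Qed.

Definition gamma_integrand (z : C) (t : R) : C :=
  Cmult (Rcpow t (Cminus z (RtoC 1))) (RtoC (exp (- t))).

Lemma continuous_gamma_integrand z x : 0 < x -> continuous (gamma_integrand z) x.
Proof.
  intros hx. apply continuous_Cmult.
  - now apply continuous_Rcpow.
  - apply continuous_RtoC. apply (ex_derive_continuous (V := R_NormedModule)). auto_derive; auto.
Qed.

Lemma Cmod_gamma_integrand z t : Cmod (gamma_integrand z t) = exp ((Re z - 1) * ln t - t).
Proof.
  unfold gamma_integrand. rewrite Cmod_mult, Cmod_Rcpow, Cmod_R, Rabs_pos_eq by (left; apply exp_pos).
  rewrite <- exp_plus. f_equal.
Qed.

Lemma is_RInt_gen_CGamma z : 0 < Re z ->
  is_RInt_gen (gamma_integrand z) (at_right 0) (Rbar_locally p_infty) (CGamma z).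
Proof.
  intros hz. apply (RInt_gen_correct (V := C_R_CompleteNormedModule)).
  destruct (power_exp_bounded (Re z + 1)) as [M [hM HM]]; [lra|].
  destruct (ex_RInt_gen_Cdominated half_line_ends (gamma_integrand z)
    (fun t => M * exp ((Re z - 1) * ln t - (Re z + 1) * ln (1 + t))) (M * / Re z)) as [I HI].
  - apply continuous_gamma_integrand.
  - intros t ht. apply (ex_derive_continuous (V := R_NormedModule)). auto_derive. lra.
  - intros t ht. rewrite Cmod_gamma_integrand.
    replace ((Re z - 1) * ln t - t) with
     (((Re z + 1) * ln (1 + t) - t) + ((Re z - 1) * ln t - (Re z + 1) * ln (1 + t))) by ring.
    rewrite exp_plus. apply Rmult_le_compat_r; [left; apply exp_pos|]. now apply HM.
  - apply (is_RInt_gen_scal (V := R_NormedModule)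
      (fun t => exp ((Re z - 1) * ln t - (Re z + 1) * ln (1 + t))) M).
    now apply is_RInt_gen_power_quotient.
  - now exists I.
Qed.

Lemma filterlim_power_exp_infty a : 0 < a ->
  filterlim (fun t => exp (a * ln t - t)) (Rbar_locally p_infty) (locally 0).
Proof.
  intros ha. destruct (power_exp_bounded (a + 1)) as [M [hM HM]]; [lra|].
  intros P [eps HP]. assert (pe := cond_pos eps). exists (M / eps). intros t ht. apply HP.
  assert (0 < M / eps) by (apply Rdiv_lt_0_compat; lra).
  change (Rabs (exp (a * ln t - t) - 0) < eps).
  rewrite Rminus_0_r, Rabs_pos_eq by (left; apply exp_pos).
  assert (h := HM t ltac:(lra)).
  assert (l : ln t < ln (1 + t)) by (apply ln_increasing; lra).
  assert (k : exp ((a + 1) * ln t - t) < M).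
  { eapply Rlt_le_trans; [|exact h]. apply exp_increasing. nra. }
  replace ((a + 1) * ln t - t) with (ln t + (a * ln t - t)) in k by ring.
  rewrite exp_plus, exp_ln in k by lra.
  apply Rmult_lt_reg_l with t; [lra|]. eapply Rlt_trans; [exact k|].
  apply (Rmult_lt_compat_r eps) in ht; [|lra]. unfold Rdiv in ht.
  rewrite Rmult_assoc, Rinv_l in ht by lra. lra.
Qed.

(** By parts, through the primitive t^z e^(-t), which vanishes at both ends. Both integrals are
    known to converge, so uniqueness of the value gives the relation. *)
Lemma CGamma_succ z : 0 < Re z -> CGamma (Cplus z (RtoC 1)) = Cmult z (CGamma z).
Proof.
  intros hz.
  assert (hz1 : 0 < Re (Cplus z (RtoC 1))) by (unfold Re in *; simpl; lra).
  assert (e : Cminus (Cplus z (RtoC 1)) (RtoC 1) = z) by ring.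
  assert (d : forall x, 0 < x -> is_Cderive (fun t => Cmult (Rcpow t z) (RtoC (exp (- t)))) x
     (Cplus (Cmult z (gamma_integrand z x))
        (Cmult (Copp (RtoC 1)) (gamma_integrand (Cplus z (RtoC 1)) x)))).
  { intros x hx. unfold gamma_integrand. rewrite e.
    replace (Cplus _ _) with (Cplus (Cmult (Cmult z (Rcpow x (Cminus z (RtoC 1)))) (RtoC (exp (- x))))
       (Cmult (Rcpow x z) (RtoC (- exp (- x))))).
    - apply (is_Cderive_mult (fun t => Rcpow t z) (fun t => RtoC (exp (- t)))).
      + now apply is_Cderive_Rcpow.
      + apply is_Cderive_RtoC. auto_derive; auto. ring.
    - rewrite RtoC_opp. ring. }
  assert (c : forall x, 0 < x -> continuous (fun x => Cplus (Cmult z (gamma_integrand z x))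
        (Cmult (Copp (RtoC 1)) (gamma_integrand (Cplus z (RtoC 1)) x))) x).
  { intros x hx. apply continuous_Cplus; apply continuous_Cmult;
      try apply continuous_const; now apply continuous_gamma_integrand. }
  assert (m : forall t, Cmod (Cmult (Rcpow t z) (RtoC (exp (- t)))) = exp (Re z * ln t - t)).
  { intros t. assert (k := Cmod_gamma_integrand (Cplus z (RtoC 1)) t).
    unfold gamma_integrand in k. rewrite e in k. rewrite k. f_equal. unfold Re; simpl; ring. }
  assert (i1 := is_RInt_gen_Cantiderivative half_line_ends _ _ (RtoC 0) (RtoC 0) d c).
  assert (i2 := is_RInt_gen_Cplus _ _ _ _
    (is_RInt_gen_Cmult _ z _ (is_RInt_gen_CGamma z hz))
    (is_RInt_gen_Cmult _ (Copp (RtoC 1)) _ (is_RInt_gen_CGamma _ hz1))).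
  assert (i3 : Cminus (RtoC 0) (RtoC 0) =
     Cplus (Cmult z (CGamma z)) (Cmult (Copp (RtoC 1)) (CGamma (Cplus z (RtoC 1))))).
  { refine (is_RInt_gen_unique_on (V := C_R_CompleteNormedModule) half_line_ends _ _ _ (i1 _ _) i2).
    - apply (filterlim_C_zero _ (fun t => exp (Re z * ln t))).
      + generalize (ends_left _ _ _ half_line_ends). apply filter_imp. intros t ht.
        rewrite m. left; apply exp_increasing. lra.
      + now apply filterlim_exp_ln_0.
    - apply (filterlim_C_zero _ (fun t => exp (Re z * ln t - t))).
      + apply filter_forall. intros t. rewrite m. lra.
      + now apply filterlim_power_exp_infty. }

  transitivity (Cplus (CGamma (Cplus z (RtoC 1))) (Cminus (RtoC 0) (RtoC 0))); [ring|].
  rewrite i3. ring.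
Qed.

(** These integer moments are all that the asymptotics of Gamma will need. *)
Lemma is_RInt_gen_fact n :
  is_RInt_gen (fun t => t ^ n * exp (- t)) (at_right 0) (Rbar_locally p_infty) (INR (fact n)).
Proof.
  assert (L : forall n, (0 < n)%nat ->
    filterlim (fun t => - (t ^ n * exp (- t))) (Rbar_locally p_infty) (locally 0)).
  { intros k hk. rewrite <- Ropp_0. apply filterlim_Ropp.
    apply filterlim_ext_loc with (f := fun t => exp (INR k * ln t - t)).
    - exists 0. intros t ht. unfold Rminus. rewrite exp_plus.
      f_equal. fold (Rpower t (INR k)). now apply Rpower_pow.
    - apply filterlim_power_exp_infty. now apply lt_0_INR. }
  (* For exponent 0 the value at the left end is -1, since [0 ^ 0] is 1; this is what produces 0! =
     1. *)
  assert (L0 : forall n, filterlim (fun t => - (t ^ n * exp (- t))) (at_right 0)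
     (locally (- (0 ^ n * exp (- 0))))).
  { intros k. eapply filterlim_filter_le_1; [apply filter_le_within|].
    apply (ex_derive_continuous (V := R_NormedModule) (fun t => - (t ^ k * exp (- t)))).
    auto_derive; auto. }
  induction n as [|n IH].
  - replace (INR (fact 0)) with (0 - - (0 ^ 0 * exp (- 0))) by
      (simpl; rewrite Ropp_0, exp_0; ring).
    apply (is_RInt_gen_antiderivative half_line_ends (fun t => - (t ^ 0 * exp (- t)))).
    + intros x hx. auto_derive; auto. simpl. ring.
    + intros x hx. apply (ex_derive_continuous (V := R_NormedModule)). auto_derive; auto.
    + apply L0.
    + assert (K := is_lim_exp_m).
      apply filterlim_ext with (f := fun t => - exp (- t)); [intros; simpl; ring|].
      rewrite <- Ropp_0. apply filterlim_Ropp.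
      eapply filterlim_comp; [|exact K]. apply (filterlim_Rbar_opp p_infty).
  - assert (i : is_RInt_gen (fun t => t ^ S n * exp (- t) + - (INR (S n) * (t ^ n * exp (- t))))
       (at_right 0) (Rbar_locally p_infty) (0 - - (0 ^ S n * exp (- 0)))).
    { apply (is_RInt_gen_antiderivative half_line_ends (fun t => - (t ^ S n * exp (- t)))).
      + intros x hx. auto_derive; auto. simpl. ring.
      + intros x hx. apply (ex_derive_continuous (V := R_NormedModule)). auto_derive; auto.
      + apply L0.
      + apply L; lia. }
    assert (j := is_RInt_gen_plus _ _ _ _ i
      (is_RInt_gen_scal (V := R_NormedModule) _ (INR (S n)) _ IH)).
    replace (INR (fact (S n))) with
      ((0 - - (0 ^ S n * exp (- 0))) + INR (S n) * INR (fact n)).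
    + revert j. apply (is_RInt_gen_ext_on (V := R_NormedModule) half_line_ends).
      intros x hx. unfold plus, scal; simpl; unfold mult; simpl. ring.
    + change (fact (S n)) with (S n * fact n)%nat. rewrite mult_INR. simpl. ring.
Qed.

(** * Asymptotics of Gamma along z + n *)

Lemma exp_sub_1_bound x : Rabs (exp x - 1) <= Rabs x * Rmax 1 (exp x).
Proof.
  assert (hp := exp_pos x).
  destruct (Rle_dec 0 x) as [h|h].
  - assert (1 <= exp x) by (assert (k := exp_ineq1_le x); lra).
    rewrite !Rabs_pos_eq, Rmax_right by lra.
    assert (k := exp_ineq1_le (- x)). rewrite exp_Ropp in k.
    apply (Rmult_le_compat_l (exp x)) in k; [|lra]. rewrite Rinv_r in k; lra.
  - assert (k := exp_ineq1_le x).
    assert (exp x < 1) by (rewrite <- exp_0; apply exp_increasing; lra).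
    rewrite !Rabs_left, Rmax_left by lra. lra.
Qed.

Lemma one_sub_cos_bound x : 2 * (1 - cos x) <= x ^ 2.
Proof.
  assert (P : forall y, 0 <= y -> (sin y) ^ 2 <= y ^ 2).
  { intros y hy. destruct (Rle_dec y 1) as [h|h].
    - destruct (Req_dec y 0) as [e|e]; [subst; rewrite sin_0; lra|].
      assert (sin y < y) by (apply sin_lt_x; lra).
      assert (0 <= sin y) by (apply sin_ge_0; [lra|]; assert (k := PI2_1); lra).
      nra.
    - assert (k := SIN_bound y). nra. }
  assert (Q : (sin (x / 2)) ^ 2 <= (x / 2) ^ 2).
  { destruct (Rle_dec 0 x) as [h|h]; [apply P; lra|].
    assert (k := P (- (x / 2)) ltac:(lra)). rewrite sin_neg in k. nra. }
  assert (e : cos x = 1 - 2 * sin (x / 2) * sin (x / 2)).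
  { rewrite <- cos_2a_sin. f_equal. field. }
  rewrite e. nra.
Qed.

(** With y^z = e^(A + iB) one has |y^z - 1|^2 = (e^A - 1)^2 + 2 e^A (1 - cos B), and the two terms
    are at most A^2 and B^2 times the square of the maximum. *)
Lemma Cmod_Rcpow_sub_1 y z :
  Cmod (Cminus (Rcpow y z) (RtoC 1)) <= Cmod z * Rabs (ln y) * Rmax 1 (exp (Re z * ln y)).
Proof.
  set (M := Rmax 1 (exp (Re z * ln y))).
  assert (M1 : 1 <= M) by apply Rmax_l.
  assert (M2 : exp (Re z * ln y) <= M) by apply Rmax_r.
  assert (hp := exp_pos (Re z * ln y)).
  assert (h1 := exp_sub_1_bound (Re z * ln y)). fold M in h1.
  assert (h2 := one_sub_cos_bound (Im z * ln y)).
  assert (h1' : (exp (Re z * ln y) - 1) ^ 2 <= (Re z * ln y) ^ 2 * M ^ 2).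
  { rewrite <- (pow2_abs (exp _ - 1)), <- (pow2_abs (Re z * ln y)), <- Rpow_mult_distr.
    apply pow_incr. split; [apply Rabs_pos|auto]. }
  assert (h2' : exp (Re z * ln y) * (2 * (1 - cos (Im z * ln y))) <= (Im z * ln y) ^ 2 * M ^ 2).
  { apply Rle_trans with (exp (Re z * ln y) * (Im z * ln y) ^ 2).
    - apply Rmult_le_compat_l; lra.
    - rewrite Rmult_comm. apply Rmult_le_compat_l; [apply pow2_ge_0|]. nra. }
  assert (s2 : forall w, Cmod w ^ 2 = fst w ^ 2 + snd w ^ 2).
  { intros w. unfold Cmod. apply pow2_sqrt. nra. }
  apply Rsqr_incr_0.
  - rewrite !Rsqr_pow2, !Rpow_mult_distr, !s2, pow2_abs. simpl fst; simpl snd.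
    assert (k := sin2_cos2 (Im z * ln y)). unfold Rsqr in k. unfold Re, Im in *.
    set (e := exp _) in *. set (cs := cos _) in *. set (sn := sin _) in *.
    replace ((fst z ^ 2 + snd z ^ 2) * ln y ^ 2 * M ^ 2) with
      ((fst z * ln y) ^ 2 * M ^ 2 + (snd z * ln y) ^ 2 * M ^ 2) by ring.
    replace ((e * cs + - (1)) ^ 2 + (e * sn + - 0) ^ 2) with
      ((e - 1) ^ 2 + e * (2 * (1 - cs)) + e ^ 2 * (sn * sn + cs * cs - 1)) by ring.
    rewrite k. lra.
  - apply Cmod_ge_0.
  - assert (0 <= Cmod z) by apply Cmod_ge_0. assert (0 <= Rabs (ln y)) by apply Rabs_pos.
    apply Rmult_le_pos; [|lra]. now apply Rmult_le_pos.
Qed.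

(** Trades the real power for an integer one, so that integration against t^(p+2) e^(-t) meets
    factorials only. *)
Lemma Cmod_Rcpow_sub_1_polynomial y z k : 0 < y -> 0 <= Re z <= INR k ->
  Cmod (Cminus (Rcpow y z) (RtoC 1)) <= Cmod z * Rabs (ln y) * (1 + y ^ k).
Proof.
  intros hy hz. eapply Rle_trans; [apply Cmod_Rcpow_sub_1|].
  apply Rmult_le_compat_l.
  { apply Rmult_le_pos; [apply Cmod_ge_0 | apply Rabs_pos]. }
  assert (hk : 0 < y ^ k) by now apply pow_lt.
  apply Rmax_lub; [lra|].
  destruct (Rle_dec (ln y) 0) as [h|h].
  - assert (exp (Re z * ln y) <= exp 0); [|rewrite exp_0 in *; lra].
    apply exp_le_compat. nra.
  - rewrite <- (Rpower_pow k y hy). unfold Rpower.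
    assert (exp (Re z * ln y) <= exp (INR k * ln y)); [|lra].
    apply exp_le_compat. nra.
Qed.

(** The tangent bound for ln, applied to y and to 1/y according to the sign of ln y. The result
    again has only integer powers, now also negative ones. *)
Lemma ln_sqr_bound y : 0 < y -> (ln y) ^ 2 <= (y - 1) ^ 2 + (/ y - 1) ^ 2.
Proof.
  intros hy. assert (h1 := ln_le_sub_1 y hy).
  assert (h2 := ln_le_sub_1 (/ y) (Rinv_0_lt_compat _ hy)). rewrite ln_Rinv in h2 by auto.
  assert (0 <= (y - 1) ^ 2) by apply pow2_ge_0.
  assert (0 <= (/ y - 1) ^ 2) by apply pow2_ge_0.
  destruct (Rle_dec 0 (ln y)).
  - assert ((ln y) ^ 2 <= (y - 1) ^ 2) by (apply pow_incr; lra). lra.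
  - assert ((- ln y) ^ 2 <= (/ y - 1) ^ 2) by (apply pow_incr; lra). nra.
Qed.

(** Factor by factor: p + 2 + i <= i (p + 3) for i >= 1. *)
Lemma fact_shift_le p j : INR (fact (p + 2 + j)) <= INR (fact (p + 2)) * INR (fact j) * INR (p + 3) ^ j.
Proof.
  induction j as [|j IH].
  - rewrite Nat.add_0_r. simpl. lra.
  - replace (p + 2 + S j)%nat with (S (p + 2 + j)) by lia.
    change (fact (S (p + 2 + j))) with (S (p + 2 + j) * fact (p + 2 + j))%nat.
    change (fact (S j)) with (S j * fact j)%nat. rewrite !mult_INR.
    replace (INR (fact (p + 2)) * (INR (S j) * INR (fact j)) * INR (p + 3) ^ S j) with
      ((INR (S j) * INR (p + 3)) * (INR (fact (p + 2)) * INR (fact j) * INR (p + 3) ^ j))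
      by (simpl; ring).
    apply Rmult_le_compat; try apply pos_INR; auto.
    rewrite !S_INR, !plus_INR. assert (0 <= INR p) by apply pos_INR.
    assert (0 <= INR j) by apply pos_INR. simpl. nra.
Qed.

Lemma is_RInt_gen_Rplus {Fa Fb} {FFa : Filter Fa} {FFb : Filter Fb} (f g : R -> R) (l l' : R) :
  is_RInt_gen f Fa Fb l -> is_RInt_gen g Fa Fb l' ->
  is_RInt_gen (fun t => f t + g t) Fa Fb (l + l').
Proof. exact (is_RInt_gen_plus f g l l'). Qed.

Lemma is_RInt_gen_Rmult {Fa Fb} {FFa : Filter Fa} {FFb : Filter Fb} (f : R -> R) (k l : R) :
  is_RInt_gen f Fa Fb l -> is_RInt_gen (fun t => k * f t) Fa Fb (k * l).
Proof. exact (is_RInt_gen_scal (V := R_NormedModule) f k l). Qed.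

(* Under the Gamma(n) density, t/n has mean 1 and variance 1/n, so (t/n)^z is close to 1;
   the parameter d balances the two terms of an AM-GM estimate. *)
Lemma CGamma_shift_estimate z k p d : 0 <= Re z <= INR k -> 0 < d ->
  Cmod (Cminus (CGamma (Cplus z (RtoC (INR (p + 3)))))
     (Cmult (Rcpow (INR (p + 3)) z) (RtoC (INR (fact (p + 2)))))) <=
  Cmod (Rcpow (INR (p + 3)) z) * INR (fact (p + 2)) *
   (Cmod z / 2 * (d * (1 + 2 * INR (fact k) + INR (fact (2 * k))) + 9 / (INR (p + 3) * d))).
Proof.
  intros hz hd. set (n := INR (p + 3)).
  assert (hp : 0 <= INR p) by apply pos_INR.
  assert (en : n = INR p + 3) by (unfold n; rewrite plus_INR; simpl; ring).
  assert (hn : 0 < n) by lra.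
  set (N := Rcpow n z). set (z' := Cplus z (RtoC n)).
  assert (hz' : 0 < Re z') by (unfold z', Re in *; simpl; lra).
  pose (f := fun j t => t ^ j * exp (- t)).
  assert (F : forall j, is_RInt_gen (f j) (at_right 0) (Rbar_locally p_infty) (INR (fact j)))
    by apply is_RInt_gen_fact.
  assert (i1 := is_RInt_gen_Cplus _ _ _ _ (is_RInt_gen_CGamma z' hz')
     (is_RInt_gen_Cmult _ (Copp N) _ (is_RInt_gen_RtoC _ _ (F (p + 2)%nat)))).
  (* Term by term this is |N| |z|/2 times d (1 + y^k)^2 + ((y - 1)^2 + (1/y - 1)^2)/d with y = t/n,
     against t^(p+2) e^(-t). The factor 1/y^2 lowers the exponent to p, which is why the shift
     starts at 3. *)
  assert (i2 := is_RInt_gen_Rmult _ (Cmod N * (Cmod z / 2)) _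
    (is_RInt_gen_Rplus _ _ _ _
      (is_RInt_gen_Rmult _ d _ (is_RInt_gen_Rplus _ _ _ _ (F (p + 2)%nat)
        (is_RInt_gen_Rplus _ _ _ _
          (is_RInt_gen_Rmult _ (2 / n ^ k) _ (F (p + 2 + k)%nat))
          (is_RInt_gen_Rmult _ (/ n ^ (2 * k)) _ (F (p + 2 + 2 * k)%nat)))))
      (is_RInt_gen_Rmult _ (/ d) _ (is_RInt_gen_Rplus _ _ _ _
        (is_RInt_gen_Rplus _ _ _ _
          (is_RInt_gen_Rmult _ (/ n ^ 2) _ (F (p + 4)%nat))
          (is_RInt_gen_Rmult _ (- 2 / n) _ (F (p + 3)%nat)))
        (is_RInt_gen_Rplus _ _ _ _
          (is_RInt_gen_Rmult _ 2 _ (F (p + 2)%nat))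
          (is_RInt_gen_Rplus _ _ _ _
            (is_RInt_gen_Rmult _ (- 2 * n) _ (F (p + 1)%nat))
            (is_RInt_gen_Rmult _ (n ^ 2) _ (F p)))))))).
  replace (Cminus (CGamma z') (Cmult N (RtoC (INR (fact (p + 2)))))) with
    (Cplus (CGamma z') (Cmult (Copp N) (RtoC (INR (fact (p + 2)))))) by ring.
  eapply Rle_trans.
  - refine (Cmod_RInt_gen_le half_line_ends _ _ _ _ _ i1 i2).
    intros t ht.
    set (y := t / n). assert (hy : 0 < y) by now apply Rdiv_lt_0_compat.
    assert (et : t = n * y) by (unfold y; field; lra).
    assert (e1 : gamma_integrand z' t =
      Cmult (Cmult N (Rcpow y z)) (RtoC (f (p + 2)%nat t))).
    { unfold gamma_integrand, f.
      replace (Cminus z' (RtoC 1)) with (Cplus z (RtoC (INR (p + 2)))).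
      - rewrite Rcpow_plus, Rcpow_nat by auto.
        rewrite et at 1. rewrite Rcpow_mult by auto. rewrite RtoC_mult. fold N. ring.
      - unfold z', Cminus. rewrite <- RtoC_opp, <- Cplus_assoc, <- RtoC_plus. do 2 f_equal.
        rewrite en, plus_INR. simpl. ring. }
    rewrite e1.
    replace (Cplus _ _) with (Cmult N (Cmult (RtoC (f (p + 2)%nat t)) (Cminus (Rcpow y z) (RtoC 1))))
      by ring.
    assert (hf : 0 < f (p + 2)%nat t).
    { apply Rmult_lt_0_compat; [now apply pow_lt | apply exp_pos]. }
    rewrite !Cmod_mult, Cmod_R, (Rabs_pos_eq (f _ _)) by lra.
    rewrite Rmult_assoc. apply Rmult_le_compat_l; [apply Cmod_ge_0|].
    assert (B := Cmod_Rcpow_sub_1_polynomial y z k hy hz).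
    assert (L := ln_sqr_bound y hy). rewrite <- pow2_abs in L.
    set (l := Rabs (ln y)) in *. set (w := y ^ k) in *.
    assert (hw : 0 < w) by now apply pow_lt.
    assert (AG : l * (1 + w) <= / 2 * (d * (1 + w) ^ 2 + / d * ((y - 1) ^ 2 + (/ y - 1) ^ 2))).
    { apply Rle_trans with (/ 2 * (d * (1 + w) ^ 2 + / d * l ^ 2)).
      - assert (0 <= (d * (1 + w) - l) ^ 2) by apply pow2_ge_0.
        assert (0 < / d) by now apply Rinv_0_lt_compat.
        apply Rmult_le_reg_l with (2 * d); [lra|].
        replace (2 * d * (/ 2 * (d * (1 + w) ^ 2 + / d * l ^ 2))) with
          (d ^ 2 * (1 + w) ^ 2 + l ^ 2) by (field; lra).
        nra.
      - apply Rmult_le_compat_l; [lra|]. apply Rplus_le_compat_l.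
        apply Rmult_le_compat_l; auto. left; now apply Rinv_0_lt_compat. }
    apply Rle_trans with (f (p + 2)%nat t * (Cmod z * (l * (1 + w)))).
    { apply Rmult_le_compat_l; lra. }
    apply Rle_trans with (f (p + 2)%nat t * (Cmod z *
      (/ 2 * (d * (1 + w) ^ 2 + / d * ((y - 1) ^ 2 + (/ y - 1) ^ 2))))).
    { apply Rmult_le_compat_l; [lra|]. apply Rmult_le_compat_l; [apply Cmod_ge_0|auto]. }
    apply Req_le. unfold f, w. rewrite !pow_add, !pow_mult, et, !Rpow_mult_distr, <- !pow_mult.
    replace (2 * k)%nat with (k + k)%nat by lia. rewrite !pow_add. simpl (_ ^ 1). simpl (_ ^ 2).
    simpl (_ ^ 3); simpl (_ ^ 4).
    field. repeat split; try lra. apply pow_nonzero; lra.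
  - assert (hq : 0 < INR (fact p)) by apply INR_fact_lt_0.
    assert (C0 : 0 <= Cmod N * (Cmod z / 2)).
    { assert (0 <= Cmod N) by apply Cmod_ge_0. assert (0 <= Cmod z) by apply Cmod_ge_0.
      apply Rmult_le_pos; lra. }
    match goal with |- _ <= ?a * ?b * (?c * ?e) => replace (a * b * (c * e)) with ((a * c) *
      (b * e)) by ring end.
    apply Rmult_le_compat_l; auto.
    rewrite (Rmult_plus_distr_l (INR (fact (p + 2)))). apply Rplus_le_compat.
    + replace (INR (fact (p + 2)) * (d * (1 + 2 * INR (fact k) + INR (fact (2 * k))))) with
        (d * (INR (fact (p + 2)) + (2 / n ^ k * (INR (fact (p + 2)) * INR (fact k) * n ^ k)
         + / n ^ (2 * k) * (INR (fact (p + 2)) * INR (fact (2 * k)) * n ^ (2 * k))))).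
      2:{ field. split; apply pow_nonzero; lra. }
      assert (forall j, 0 < n ^ j) by (intros; now apply pow_lt).
      apply Rmult_le_compat_l; [lra|]. apply Rplus_le_compat_l. apply Rplus_le_compat.
      * apply Rmult_le_compat_l; [|apply fact_shift_le].
        apply Rmult_le_pos; [lra|]. left; now apply Rinv_0_lt_compat.
      * apply Rmult_le_compat_l; [|apply fact_shift_le].
        left; now apply Rinv_0_lt_compat.
    + replace (p + 4)%nat with (S (S (S (S p)))) by lia.
      replace (p + 3)%nat with (S (S (S p))) by lia.
      replace (p + 2)%nat with (S (S p)) by lia. replace (p + 1)%nat with (S p) by lia.
      rewrite !fact_simpl, !mult_INR, !S_INR.
      replace (INR p) with (n - 3) by lra. assert (3 <= n) by lra.
      set (q := INR (fact p)) in *.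
      replace (_ * (9 / (n * d))) with (/ d * (q * ((n - 1) * (n - 2) * (9 / n)))) by (field; lra).
      apply Rmult_le_compat_l; [left; now apply Rinv_0_lt_compat|].
      (* The squares of y - 1 and 1/y - 1 contribute (n - 1)(n - 2)/n and n + 2, times p!. The claim
         becomes 2n^2 - n + 2 <= 9 (n - 1)(n - 2), which holds from n = 3 on, where it reads 17 <=
         18; hence the constant 9. *)
      match goal with |- ?X <= _ => replace X with (q * (((n - 1) * (n - 2) + n *
        (n + 2)) / n)) by (field; lra) end.
      apply Rmult_le_compat_l; [lra|]. apply Rmult_le_reg_l with n; auto.
      field_simplify; try lra. nra.
Qed.

Lemma filterlim_Cdiv_1 (u v : nat -> C) (e : nat -> R) :
  (forall p, v p <> RtoC 0) ->
  (forall p, Cmod (Cminus (u p) (v p)) <= Cmod (v p) * e p) ->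
  filterlim e eventually (locally 0) ->
  filterlim (fun p => Cdiv (u p) (v p)) eventually (locally (RtoC 1)).
Proof.
  intros hv h he.
  apply filterlim_ext with
    (f := fun p => Cplus (RtoC 1) (Cdiv (Cminus (u p) (v p)) (v p))).
  { intros p. field. apply hv. }
  replace (locally (RtoC 1)) with (locally (Cplus (RtoC 1) (RtoC 0))) by (f_equal; ring).
  apply filterlim_Cplus; [apply filterlim_const|].
  apply (filterlim_C_zero _ e); auto.
  apply filter_forall. intros p. rewrite Cmod_div by apply hv.
  assert (0 < Cmod (v p)) by (apply Cmod_gt_0, hv).
  apply Rmult_le_reg_l with (Cmod (v p)); auto.
  eapply Rle_trans; [|apply h]. apply Req_le. field. lra.
Qed.

Lemma filterlim_const_div_sqrt K :
  filterlim (fun p => K / sqrt (INR (p + 3))) eventually (locally 0).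
Proof.
  intros P [eps HP]. assert (pe := cond_pos eps).
  destruct (nfloor_ex ((Rabs K / eps) ^ 2) ltac:(apply pow2_ge_0)) as [N [_ hN]].
  exists N. intros p hp. apply HP.
  assert (hs : Rabs K / eps < sqrt (INR (p + 3))).
  { assert (0 <= Rabs K / eps).
    { apply Rmult_le_pos; [apply Rabs_pos|]. left; now apply Rinv_0_lt_compat. }
    rewrite <- (sqrt_pow2 (Rabs K / eps)) by auto. apply sqrt_lt_1.
    - apply pow2_ge_0.
    - apply pos_INR.
    - eapply Rlt_le_trans; [exact hN|]. rewrite <- S_INR. apply le_INR. lia. }
  assert (hs0 : 0 < sqrt (INR (p + 3))) by (apply sqrt_lt_R0, lt_0_INR; lia).
  change (Rabs (K / sqrt (INR (p + 3)) - 0) < eps).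
  rewrite Rminus_0_r. unfold Rdiv. rewrite Rabs_mult, (Rabs_pos_eq (/ _)).
  - apply Rmult_lt_reg_r with (sqrt (INR (p + 3))); auto.
    rewrite Rmult_assoc, Rinv_l, Rmult_1_r by lra.
    apply (Rmult_lt_compat_l eps) in hs; auto.
    replace (eps * (Rabs K / eps)) with (Rabs K) in hs by (field; lra). lra.
  - left. now apply Rinv_0_lt_compat.
Qed.

Lemma CGamma_asymptotic z : 0 <= Re z ->
  filterlim (fun p => Cdiv (CGamma (Cplus z (RtoC (INR (p + 3)))))
      (Cmult (Rcpow (INR (p + 3)) z) (RtoC (INR (fact (p + 2))))))
    eventually (locally (RtoC 1)).
Proof.
  intros hz. destruct (nfloor_ex (Re z) hz) as [k [_ hk]].
  set (K := Cmod z / 2 * ((1 + 2 * INR (fact (S k)) + INR (fact (2 * S k))) + 9)).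
  apply filterlim_Cdiv_1 with (e := fun p => K / sqrt (INR (p + 3))).
  - intros p. apply Cmult_neq_0; [apply Rcpow_neq_0|].
    intros e. apply (INR_fact_neq_0 (p + 2)). now apply RtoC_inj.
  - intros p.
    assert (hn : 0 < INR (p + 3)) by (apply lt_0_INR; lia).
    assert (hs : 0 < sqrt (INR (p + 3))) by now apply sqrt_lt_R0.
    eapply Rle_trans.
    (* With d = 1/sqrt n both error terms have order 1/sqrt n. The integer is [S k] because [k] is
       the floor of Re z. *)
    + apply (CGamma_shift_estimate z (S k) p (/ sqrt (INR (p + 3)))).
      * rewrite S_INR. lra.
      * now apply Rinv_0_lt_compat.
    + rewrite Cmod_mult, Cmod_R, (Rabs_pos_eq (INR _)) by apply pos_INR.
      apply Req_le. f_equal. unfold K.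
      rewrite <- (sqrt_sqrt (INR (p + 3))) at 2 by lra. field. lra.
  - apply filterlim_const_div_sqrt.
Qed.

Lemma CGamma_shift z n : 0 < Re z ->
  CGamma (Cplus z (RtoC (INR n))) = Cmult (poch z n) (CGamma z).
Proof.
  intros hz. induction n as [|n IH].
  - simpl. replace (Cplus z (RtoC 0)) with z by ring. ring.
  - rewrite S_INR, RtoC_plus, Cplus_assoc, CGamma_succ, IH.
    + simpl. ring.
    + assert (0 <= INR n) by apply pos_INR. unfold Re in *; simpl; lra.
Qed.

(** By the functional equation a zero at z is a zero at every z + n, so the ratio that tends to 1
    would be constantly 0. *)
Lemma CGamma_neq_0 z : 0 < Re z -> CGamma z <> RtoC 0.
Proof.
  intros hz h.
  assert (L := CGamma_asymptotic z ltac:(lra)).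
  assert (L0 : filterlim (fun _ : nat => RtoC 0) eventually (locally (RtoC 1))).
  { eapply filterlim_ext; [|exact L]. intros p. simpl.
    rewrite CGamma_shift, h by auto. unfold Cdiv. ring. }
  assert (e := filterlim_locally_unique (V := C_R_NormedModule) _ _ _
    (filterlim_const (F := eventually) (RtoC 0)) L0).
  apply RtoC_inj in e. lra.
Qed.

(** * Integrals over (0,1) with power singularities at the ends *)

Lemma filterlim_one_sub : filterlim (fun t => 1 - t) (at_left 1) (at_right 0).
Proof.
  intros P [eps HP]. exists eps. intros t ht ht1. apply HP; [|lra].
  change (Rabs (t - 1) < eps) in ht. change (Rabs (1 - t - 0) < eps).
  rewrite Rminus_0_r, <- Rabs_Ropp. now replace (- (1 - t)) with (t - 1) by ring.
Qed.

Lemma is_RInt_gen_unit_powers r s : -1 < r -> -1 < s ->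
  is_RInt_gen (fun t => exp (r * ln t) + exp (s * ln (1 - t))) (at_right 0) (at_left 1)
   (/ (r + 1) + / (s + 1)).
Proof.
  intros hr hs.
  assert (C1 : forall a, continuous (fun t => exp (a * ln t)) 1).
  { intros a. apply (ex_derive_continuous (V := R_NormedModule)). auto_derive. lra. }
  replace (/ (r + 1) + / (s + 1)) with
    ((/ (r + 1) * exp ((r + 1) * ln 1) + - (/ (s + 1)) * 0) -
     (/ (r + 1) * 0 + - (/ (s + 1)) * exp ((s + 1) * ln (1 - 0)))).
  2:{ rewrite Rminus_0_r, ln_1, !Rmult_0_r, exp_0. ring. }
  apply (is_RInt_gen_antiderivative unit_ends (fun t => / (r + 1) * exp ((r + 1) * ln t)
     + - (/ (s + 1)) * exp ((s + 1) * ln (1 - t)))).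
  - intros x hx. auto_derive; [lra|].
    rewrite !Rmult_plus_distr_r, !exp_plus, !Rmult_1_l, !exp_ln by lra. unfold Rminus. field. lra.
  - intros x hx. apply (ex_derive_continuous (V := R_NormedModule)). auto_derive. lra.
  - apply filterlim_Rplus; (apply filterlim_Rmult; [apply filterlim_const|]).
    + apply filterlim_exp_ln_0. lra.
    + eapply filterlim_filter_le_1; [apply filter_le_within|].
      apply (ex_derive_continuous (V := R_NormedModule) (fun t => exp ((s + 1) * ln (1 - t)))).
      auto_derive. lra.
  - apply filterlim_Rplus; (apply filterlim_Rmult; [apply filterlim_const|]).
    + eapply filterlim_filter_le_1; [apply filter_le_within|]. apply C1.
    + eapply (filterlim_comp _ _ _ (fun t => 1 - t) (fun t => exp ((s + 1) * ln t)));
      [apply filterlim_one_sub|].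
      apply filterlim_exp_ln_0. lra.
Qed.

(** On each half of the interval the power that is regular there is at most [q], so the product is
    below [q] times the sum of the two powers, which has an elementary primitive. *)
Lemma ex_RInt_gen_unit (f : R -> C) M r s : 0 <= M -> -1 < r -> -1 < s ->
  (forall t, 0 < t < 1 -> continuous f t) ->
  (forall t, 0 < t < 1 -> Cmod (f t) <= M * exp (r * ln t + s * ln (1 - t))) ->
  exists I : C, is_RInt_gen f (at_right 0) (at_left 1) I.
Proof.
  intros hM hr hs Hc H.
  set (q := exp (Rabs r * ln 2 + Rabs s * ln 2)).
  apply (ex_RInt_gen_Cdominated unit_ends f
    (fun t => (M * q) * (exp (r * ln t) + exp (s * ln (1 - t)))) ((M * q) * (/ (r + 1) + / (s + 1)))).
  - auto.
  - intros t ht. apply (ex_derive_continuous (V := R_NormedModule)). auto_derive. lra.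
  - intros t ht. eapply Rle_trans; [now apply H|]. rewrite Rmult_assoc.
    apply Rmult_le_compat_l; auto.
    assert (A : forall a x, 1 / 2 <= x < 1 -> a * ln x <= Rabs a * ln 2).
    { intros a x hx. assert (ln x < 0) by (rewrite <- ln_1; apply ln_increasing; lra).
      assert (- ln 2 <= ln x).
      { rewrite <- ln_Rinv by lra. destruct (Req_dec (/ 2) x) as [e|e]; [rewrite e; lra|].
        left. apply ln_increasing; lra. }
      assert (- a <= Rabs a) by (rewrite <- Rabs_Ropp; apply Rle_abs).
      assert (0 <= Rabs a) by apply Rabs_pos. nra. }
    assert (l2 : 0 <= ln 2) by (rewrite <- ln_1; left; apply ln_increasing; lra).
    assert (0 <= Rabs r * ln 2) by (apply Rmult_le_pos; [apply Rabs_pos|auto]).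
    assert (0 <= Rabs s * ln 2) by (apply Rmult_le_pos; [apply Rabs_pos|auto]).
    assert (p1 := exp_pos (r * ln t)). assert (p2 := exp_pos (s * ln (1 - t))).
    assert (pq : 0 < q) by apply exp_pos. rewrite Rmult_plus_distr_l.
    destruct (Rle_dec t (1 / 2)) as [h|h].
    + apply Rle_trans with (q * exp (r * ln t)); [|nra].
      unfold q. rewrite <- exp_plus. apply exp_le_compat.
      assert (k := A s (1 - t)). lra.
    + apply Rle_trans with (q * exp (s * ln (1 - t))); [|nra].
      unfold q. rewrite <- exp_plus. apply exp_le_compat.
      assert (k := A r t). lra.
  - apply is_RInt_gen_Rmult. now apply is_RInt_gen_unit_powers.
Qed.

Lemma exp_ln_mul_le a u : 0 <= a -> 0 < u < 1 ->
  exp (a * ln (u * (1 - u))) <= exp (a * ln u) /\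
  exp (a * ln (u * (1 - u))) <= exp (a * ln (1 - u)).
Proof.
  intros ha hu. rewrite ln_mult by lra.
  assert (ln u < 0) by (rewrite <- ln_1; apply ln_increasing; lra).
  assert (ln (1 - u) < 0) by (rewrite <- ln_1; apply ln_increasing; lra).
  split; apply exp_le_compat; nra.
Qed.

Lemma filterlim_central_power_zero (f : R -> C) a M : 0 < a -> 0 <= M ->
  (forall u, 0 < u < 1 -> Cmod (f u) <= M * exp (a * ln (u * (1 - u)))) ->
  filterlim f (at_right 0) (locally (RtoC 0)) /\ filterlim f (at_left 1) (locally (RtoC 0)).
Proof.
  intros ha hM H.
  assert (L := filterlim_exp_ln_0 a ha).
  assert (Z : locally 0 = locally (M * 0)) by (f_equal; ring).
  split.
  - apply (filterlim_C_zero _ (fun u => M * exp (a * ln u))).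
    + generalize (ends_left _ _ _ unit_ends). apply filter_imp. intros u hu.
      eapply Rle_trans; [now apply H|]. apply Rmult_le_compat_l; auto.
      apply exp_ln_mul_le; lra.
    + rewrite Z. apply filterlim_Rmult; auto. apply filterlim_const.
  - apply (filterlim_C_zero _ (fun u => M * exp (a * ln (1 - u)))).
    + generalize (ends_right _ _ _ unit_ends). apply filter_imp. intros u hu.
      eapply Rle_trans; [now apply H|]. apply Rmult_le_compat_l; auto.
      apply exp_ln_mul_le; lra.
    + rewrite Z. apply filterlim_Rmult; [apply filterlim_const|].
      eapply (filterlim_comp _ _ _ (fun t => 1 - t) (fun t => exp (a * ln t)));
        [apply filterlim_one_sub | exact L].
Qed.

Lemma is_Cderive_central_power z u : 0 < u < 1 ->
  is_Cderive (fun u => Rcpow (u * (1 - u)) z) u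
    (Cmult (RtoC (1 - 2 * u)) (Cmult z (Rcpow (u * (1 - u)) (Cminus z (RtoC 1))))).
Proof.
  intros hu. apply (is_Cderive_comp (fun w => Rcpow w z) (fun u => u * (1 - u))).
  - apply is_Cderive_Rcpow. nra.
  - auto_derive; auto. ring.
Qed.

(** * The central Beta integral and the duplication identity *)

Definition beta_integrand (z : C) (u : R) : C := Rcpow (u * (1 - u)) (Cminus z (RtoC 1)).

Definition central_beta (z : C) : C :=
  @RInt_gen C_R_CompleteNormedModule (beta_integrand z) (at_right 0) (at_left 1).

Lemma continuous_beta_integrand z u : 0 < u < 1 -> continuous (beta_integrand z) u.
Proof. intros hu. eapply is_Cderive_continuous, is_Cderive_central_power, hu. Qed.

Lemma is_RInt_gen_central_beta z : 0 < Re z ->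
  is_RInt_gen (beta_integrand z) (at_right 0) (at_left 1) (central_beta z).
Proof.
  intros hz. apply (RInt_gen_correct (V := C_R_CompleteNormedModule)).
  destruct (ex_RInt_gen_unit (beta_integrand z) 1 (Re z - 1) (Re z - 1)) as [I HI]; try lra.
  - apply continuous_beta_integrand.
  - intros t ht. unfold beta_integrand. rewrite Cmod_Rcpow, ln_mult, Rmult_1_l by lra.
    apply Req_le. f_equal. unfold Re, Cminus, Rminus; simpl. ring.
  - now exists I.
Qed.

Lemma RtoC_4 : RtoC 4 = Cmult (RtoC 2) (RtoC 2).
Proof. rewrite <- RtoC_mult; f_equal; ring. Qed.

(* Integrates the derivative of (1 - 2u) (u (1 - u))^z. *)
Lemma central_beta_succ z : 0 < Re z ->
  Cmult z (central_beta z) =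
  Cmult (Cplus (Cmult (RtoC 4) z) (RtoC 2)) (central_beta (Cplus z (RtoC 1))).
Proof.
  intros hz. set (k := Cplus (Cmult (RtoC 4) z) (RtoC 2)).
  assert (hz1 : 0 < Re (Cplus z (RtoC 1))) by (unfold Re in *; simpl; lra).
  assert (d : forall u, 0 < u < 1 -> is_Cderive
     (fun u => Cmult (RtoC (1 - 2 * u)) (Rcpow (u * (1 - u)) z)) u
     (Cplus (Cmult z (beta_integrand z u)) (Cmult (Copp k) (beta_integrand (Cplus z (RtoC 1)) u)))).
  { intros u hu. unfold beta_integrand.
    replace (Cminus (Cplus z (RtoC 1)) (RtoC 1)) with (Cplus (Cminus z (RtoC 1)) (RtoC 1)) by ring.
    rewrite (Rcpow_plus _ (Cminus z (RtoC 1))), Rcpow_1 by nra.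
    set (W := Rcpow (u * (1 - u)) (Cminus z (RtoC 1))).
    replace (Cplus _ _) with (Cplus (Cmult (RtoC (Ropp 2)) (Rcpow (u * (1 - u)) z))
      (Cmult (RtoC (1 - 2 * u)) (Cmult (RtoC (1 - 2 * u)) (Cmult z W)))).
    - apply (is_Cderive_mult (fun u => RtoC (1 - 2 * u)) (fun u => Rcpow (u * (1 - u)) z)).
      + apply is_Cderive_RtoC. auto_derive; auto. ring.
      + now apply is_Cderive_central_power.
    - replace (Rcpow (u * (1 - u)) z) with (Cmult W (RtoC (u * (1 - u)))).
      2:{ unfold W. rewrite <- (Rcpow_1 (u * (1 - u))) by nra. rewrite <- Rcpow_plus.
          f_equal. ring. }
      unfold k. rewrite RtoC_4. rewrite RtoC_mult, !RtoC_minus, RtoC_opp, RtoC_mult. ring. }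
  assert (c : forall u, 0 < u < 1 -> continuous (fun u => Cplus (Cmult z (beta_integrand z u))
     (Cmult (Copp k) (beta_integrand (Cplus z (RtoC 1)) u))) u).
  { intros u hu. apply continuous_Cplus; apply continuous_Cmult;
      try apply continuous_const; now apply continuous_beta_integrand. }
  destruct (filterlim_central_power_zero
     (fun u => Cmult (RtoC (1 - 2 * u)) (Rcpow (u * (1 - u)) z)) (Re z) 1) as [l0 l1]; try lra.
  { intros u hu. rewrite Cmod_mult, Cmod_R, Cmod_Rcpow.
    apply Rmult_le_compat_r; [left; apply exp_pos|]. apply Rabs_le. lra. }
  assert (i1 := is_RInt_gen_Cantiderivative unit_ends _ _ (RtoC 0) (RtoC 0) d c l0 l1).
  assert (i2 := is_RInt_gen_Cplus _ _ _ _
    (is_RInt_gen_Cmult _ z _ (is_RInt_gen_central_beta z hz))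
    (is_RInt_gen_Cmult _ (Copp k) _ (is_RInt_gen_central_beta _ hz1))).
  assert (i3 := is_RInt_gen_unique_on (V := C_R_CompleteNormedModule) unit_ends _ _ _ i1 i2).
  transitivity (Cplus (Cplus (Cmult z (central_beta z)) (Cmult (Copp k) (central_beta (Cplus z
    (RtoC 1)))))
    (Cmult k (central_beta (Cplus z (RtoC 1))))); [ring|].
  etransitivity; [apply f_equal2; [symmetry; exact i3 | reflexivity]|]. ring.
Qed.

(** The value is B(n+1, n+1), the exponent being one less than the argument. The induction uses the
    primitive (1 - 2u)(u(1 - u))^(n+1), as in [central_beta_succ]. *)
Lemma is_RInt_gen_central_beta_nat n :
  is_RInt_gen (fun u => (u * (1 - u)) ^ n) (at_right 0) (at_left 1)
    (INR (fact n) ^ 2 / INR (fact (2 * n + 1))).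
Proof.
  assert (CL : forall (f : R -> R), (forall x, ex_derive f x) ->
    filterlim f (at_right 0) (locally (f 0)) /\ filterlim f (at_left 1) (locally (f 1))).
  { intros f hf; split; (eapply filterlim_filter_le_1; [apply filter_le_within|]);
      apply (ex_derive_continuous (V := R_NormedModule) f), hf. }
  induction n as [|n IH].
  - replace (INR (fact 0) ^ 2 / INR (fact (2 * 0 + 1))) with (1 - 0) by (simpl; field).
    destruct (CL (fun u => u)) as [l0 l1]; [intros; auto_derive; auto|].
    apply (is_RInt_gen_antiderivative unit_ends (fun u => u)); auto.
    + intros x _. simpl. auto_derive; auto.
    + intros x _. simpl. apply continuous_const.
  - set (F := fun u => (1 - 2 * u) * (u * (1 - u)) ^ S n).
    destruct (CL F) as [l0 l1]; [intros; unfold F; auto_derive; auto|].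
    assert (i1 := is_RInt_gen_antiderivative unit_ends F
      (fun u => INR (S n) * (u * (1 - u)) ^ n + - (4 * INR (S n) + 2) * (u * (1 - u)) ^ S n)
      _ _ ltac:(intros x _; unfold F; auto_derive; auto;
         unfold Rminus; cbn [pow pred];
         change (match n with 0%nat => 1 | S _ => INR n + 1 end) with (INR (S n));
         generalize ((x * (1 + - x)) ^ n) (INR (S n)); intros; ring)
      ltac:(intros x _; apply (ex_derive_continuous (V := R_NormedModule)); auto_derive; auto)
      l0 l1).
    assert (i2 := is_RInt_gen_Rmult _ (INR (S n)) _ IH).
    assert (i3 := is_RInt_gen_Rplus _ _ _ _ (is_RInt_gen_Rmult _ (-1) _ i1) i2).
    assert (hk : 0 < 4 * INR (S n) + 2) by (assert (0 <= INR (S n)) by apply pos_INR; lra).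
    assert (i4 := is_RInt_gen_Rmult _ (/ (4 * INR (S n) + 2)) _ i3).
    match type of i4 with is_RInt_gen _ _ _ ?v =>
      replace (INR (fact (S n)) ^ 2 / INR (fact (2 * S n + 1))) with v end.
    + revert i4. apply (is_RInt_gen_ext_on (V := R_NormedModule) unit_ends).
      intros x _. cbv beta. match goal with |- ?a = ?b => change (@eq R a b) end. field. lra.
    + unfold F. replace (2 * S n + 1)%nat with (S (S (2 * n + 1))) by lia.
      rewrite !fact_simpl, !mult_INR, !S_INR, plus_INR, mult_INR.
      assert (h0 := INR_fact_lt_0 n). assert (h1 := INR_fact_lt_0 (2 * n + 1)).
      assert (h2 := pos_INR n). simpl. field. repeat split; try lra. apply INR_fact_neq_0.
Qed.

(** High powers of u(1 - u) concentrate at its maximum 1/4. With v = 4u(1 - u) <= 1 one has |v^z -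
    1| <= |z| (1/v - 1), and the mean of 1/v - 1 under the weight (u(1 - u))^(p+2) is exactly 1/(2(p
    + 2)). This rate is weakened to 1/sqrt n, whose limit is already at hand. *)
Lemma central_beta_asymptotic z : 0 < Re z ->
  filterlim (fun p => Cdiv (central_beta (Cplus z (RtoC (INR (p + 3)))))
      (Cmult (Rcpow (/ 4) z) (RtoC (INR (fact (p + 2)) ^ 2 / INR (fact (2 * p + 5))))))
    eventually (locally (RtoC 1)).
Proof.
  intros hz.
  set (b := fun n => INR (fact n) ^ 2 / INR (fact (2 * n + 1))).
  assert (hb : forall n, 0 < b n).
  { intros n. apply Rdiv_lt_0_compat; [apply pow_lt|]; apply INR_fact_lt_0. }
  apply filterlim_ext with (f := fun p => Cdiv (central_beta (Cplus z (RtoC (INR (p + 3)))))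
      (Cmult (Rcpow (/ 4) z) (RtoC (b (p + 2)%nat)))).
  { intros p. unfold b. now replace (2 * (p + 2) + 1)%nat with (2 * p + 5)%nat by lia. }
  apply filterlim_Cdiv_1 with (e := fun p => Cmod z / sqrt (INR (p + 3))).
  - intros p. apply Cmult_neq_0; [apply Rcpow_neq_0|].
    intros e. apply RtoC_inj in e. assert (k := hb (p + 2)%nat). lra.
  - intros p. set (N := Rcpow (/ 4) z). set (n := INR (p + 3)).
    assert (en : n = INR p + 3) by (unfold n; rewrite plus_INR; simpl; ring).
    assert (hp : 0 <= INR p) by apply pos_INR.
    set (z' := Cplus z (RtoC n)).
    assert (hz' : 0 < Re z') by (unfold z', Re in *; simpl; lra).
    assert (i1 := is_RInt_gen_Cplus _ _ _ _ (is_RInt_gen_central_beta z' hz')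
     (is_RInt_gen_Cmult _ (Copp N) _ (is_RInt_gen_RtoC _ _ (is_RInt_gen_central_beta_nat (p + 2))))).
    assert (i2 := is_RInt_gen_Rmult _ (Cmod N * Cmod z) _
      (is_RInt_gen_Rplus _ _ _ _
        (is_RInt_gen_Rmult _ (/ 4) _ (is_RInt_gen_central_beta_nat (p + 1)))
        (is_RInt_gen_Rmult _ (-1) _ (is_RInt_gen_central_beta_nat (p + 2))))).
    fold (b (p + 1)%nat) (b (p + 2)%nat) in i1, i2.
    replace (Cminus (central_beta z') (Cmult N (RtoC (b (p + 2)%nat)))) with
      (Cplus (central_beta z') (Cmult (Copp N) (RtoC (b (p + 2)%nat)))) by ring.
    eapply Rle_trans.
    + refine (Cmod_RInt_gen_le unit_ends _ _ _ _ _ i1 i2).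
      intros u hu. set (v := 4 * (u * (1 - u))).
      assert (hw : 0 < u * (1 - u)) by nra.
      assert (hv : 0 < v <= 1) by (assert (0 <= (2 * u - 1) ^ 2) by apply pow2_ge_0; unfold v; lra).
      assert (ew : u * (1 - u) = / 4 * v) by (unfold v; field).
      assert (e1 : beta_integrand z' u =
        Cmult (Cmult N (Rcpow v z)) (RtoC ((u * (1 - u)) ^ (p + 2)))).
      { unfold beta_integrand.
        replace (Cminus z' (RtoC 1)) with (Cplus z (RtoC (INR (p + 2)))).
        - rewrite Rcpow_plus, Rcpow_nat by lra. f_equal. rewrite ew. apply Rcpow_mult; lra.
        - unfold z', Cminus. rewrite <- RtoC_opp, <- Cplus_assoc, <- RtoC_plus. do 2 f_equal.
          rewrite en, plus_INR. simpl. ring. }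
      rewrite e1.
      replace (Cplus _ _) with (Cmult N (Cmult (RtoC ((u * (1 - u)) ^ (p + 2)))
         (Cminus (Rcpow v z) (RtoC 1)))) by ring.
      assert (hf : 0 < (u * (1 - u)) ^ (p + 1)) by (now apply pow_lt).
      assert (hf2 : 0 < (u * (1 - u)) ^ (p + 2)) by (now apply pow_lt).
      rewrite !Cmod_mult, Cmod_R, (Rabs_pos_eq (_ ^ _)) by lra.
      rewrite Rmult_assoc. apply Rmult_le_compat_l; [apply Cmod_ge_0|].
      assert (l0 : ln v <= 0) by (rewrite <- ln_1; apply ln_le; lra).
      assert (B : Cmod (Cminus (Rcpow v z) (RtoC 1)) <= Cmod z * (/ v - 1)).
      { eapply Rle_trans; [apply Cmod_Rcpow_sub_1|].
        rewrite Rmax_left, Rmult_1_r, Rabs_left1 by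
          (try rewrite <- exp_0; try apply exp_le_compat; nra).
        apply Rmult_le_compat_l; [apply Cmod_ge_0|].
        rewrite <- ln_Rinv by lra. apply ln_le_sub_1, Rinv_0_lt_compat. lra. }
      eapply Rle_trans; [apply Rmult_le_compat_l; [lra|exact B]|].
      apply Req_le. replace (p + 2)%nat with (S (p + 1)) by lia. simpl pow.
      unfold v. field. lra.
    + rewrite Cmod_mult, Cmod_R, (Rabs_pos_eq (b _)) by (left; apply hb).
      assert (eb : b (p + 1)%nat = (4 * INR p + 10) / (INR p + 2) * b (p + 2)%nat).
      { unfold b. replace (p + 2)%nat with (S (p + 1)) by lia.
        replace (2 * S (p + 1) + 1)%nat with (S (S (2 * (p + 1) + 1))) by lia.
        rewrite !fact_simpl, !mult_INR, !S_INR, !plus_INR, !mult_INR, !plus_INR.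
        assert (h0 := INR_fact_lt_0 (p + 1)). assert (h1 := INR_fact_lt_0 (2 * (p + 1) + 1)).
        simpl. field. repeat split; try lra; apply INR_fact_neq_0. }
      rewrite eb.
      assert (C0 : 0 <= Cmod N * Cmod z) by (apply Rmult_le_pos; apply Cmod_ge_0).
      match goal with |- ?X <= _ => replace X with
        ((Cmod N * Cmod z) * b (p + 2)%nat * (/ (2 * (INR p + 2)))) by (field; lra) end.
      replace (Cmod N * b (p + 2)%nat * (Cmod z / sqrt n)) with
        ((Cmod N * Cmod z) * b (p + 2)%nat * (/ sqrt n)) by (unfold Rdiv; ring).
      apply Rmult_le_compat_l.
      * apply Rmult_le_pos; auto. left; apply hb.
      * apply Rinv_le_contravar; [apply sqrt_lt_R0; lra|].
        rewrite <- (sqrt_pow2 (2 * (INR p + 2))) by lra. apply sqrt_le_1; nra.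
  - apply filterlim_const_div_sqrt.
Qed.

Lemma RtoC_neq_0 x : x <> 0 -> RtoC x <> RtoC 0.
Proof. intros h e. now apply h, RtoC_inj. Qed.

Lemma RtoC_2 : RtoC 2 = Cplus (RtoC 1) (RtoC 1).
Proof. rewrite <- RtoC_plus. f_equal; ring. Qed.

Lemma Re_neq_0 z : Re z <> 0 -> z <> RtoC 0.
Proof. intros h e. apply h. now rewrite e. Qed.

(** Gamma(2z + 2) = 2z (2z + 1) Gamma(2z), and [central_beta_succ] divides by 4z + 2 after
    multiplying by z; what remains is z^2. *)
Lemma beta_gamma_succ z : 0 < Re z ->
  Cmult (central_beta (Cplus z (RtoC 1))) (CGamma (Cmult (RtoC 2) (Cplus z (RtoC 1)))) =
  Cmult (Cmult z z) (Cmult (central_beta z) (CGamma (Cmult (RtoC 2) z))).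
Proof.
  intros hz. set (w := Cmult (RtoC 2) z).
  assert (hw : 0 < Re w) by (unfold w, Re in *; simpl; lra).
  replace (Cmult (RtoC 2) (Cplus z (RtoC 1))) with (Cplus (Cplus w (RtoC 1)) (RtoC 1)).
  2:{ unfold w. rewrite RtoC_2. ring. }
  rewrite (CGamma_succ (Cplus w (RtoC 1))), (CGamma_succ w) by
    (auto; unfold Re in *; simpl; lra).
  assert (k := central_beta_succ z hz).
  assert (e : Cplus (Cmult (RtoC 4) z) (RtoC 2) = Cmult (RtoC 2) (Cplus w (RtoC 1))).
  { unfold w. rewrite RtoC_4. ring. }
  rewrite e in k.
  transitivity (Cmult (Cmult (Cinv (RtoC 2)) (Cmult w (CGamma w)))
     (Cmult (Cmult (RtoC 2) (Cplus w (RtoC 1))) (central_beta (Cplus z (RtoC 1))))).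
  - field; apply RtoC_neq_0; lra.
  - rewrite <- k. unfold w. field; apply RtoC_neq_0; lra.
Qed.

Lemma beta_gamma_shift z n : 0 < Re z ->
  Cmult (central_beta (Cplus z (RtoC (INR n)))) (CGamma (Cmult (RtoC 2) (Cplus z (RtoC (INR n))))) =
  Cmult (Cmult (poch z n) (poch z n)) (Cmult (central_beta z) (CGamma (Cmult (RtoC 2) z))).
Proof.
  intros hz. induction n as [|n IH].
  - simpl. replace (Cplus z (RtoC 0)) with z by ring. ring.
  - rewrite S_INR, RtoC_plus, Cplus_assoc, beta_gamma_succ, IH.
    + simpl. ring.
    + assert (0 <= INR n) by apply pos_INR. unfold Re in *; simpl; lra.
Qed.

Lemma Rcpow_duplication x z : 0 < x ->
  Cmult (Rcpow (/ 4) z) (Rcpow (2 * x) (Cmult (RtoC 2) z)) = Cmult (Rcpow x z) (Rcpow x z).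
Proof.
  intros hx.
  replace (Cmult (RtoC 2) z) with (Cplus z z) by (rewrite RtoC_2; ring).
  rewrite Rcpow_plus, !Rcpow_mult by lra.
  transitivity (Cmult (Cmult (Rcpow (/ 4) z) (Cmult (Rcpow 2 z) (Rcpow 2 z)))
     (Cmult (Rcpow x z) (Rcpow x z))); [ring|].
  rewrite <- !Rcpow_mult by lra.
  replace (/ 4 * (2 * 2)) with 1 by field. rewrite Rcpow_base_1. rewrite Cmult_1_l.
  now rewrite Rcpow_mult.
Qed.

(* Both sides get multiplied by z^2 under z -> z + 1, and their ratio tends to 1 along z + n. *)
Lemma CGamma_sqr z : 0 < Re z ->
  Cmult (CGamma z) (CGamma z) = Cmult (central_beta z) (CGamma (Cmult (RtoC 2) z)).
Proof.
  intros hz. set (T := Cmult (central_beta z) (CGamma (Cmult (RtoC 2) z))).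
  assert (hz2 : 0 < Re (Cmult (RtoC 2) z)) by (unfold Re in *; simpl; lra).
  assert (L1 := CGamma_asymptotic z ltac:(lra)).
  assert (L2 := central_beta_asymptotic z hz).
  assert (L3 := CGamma_asymptotic _ (Rlt_le _ _ hz2)).
  (* Since 2(z + p + 3) = 2z + (2p + 3) + 3, the asymptotics for 2z are taken along the indices 2p +
     3. *)
  assert (L4 : filterlim (fun p => (2 * p + 3)%nat) eventually eventually).
  { intros P [N HN]. exists N. intros p hp. apply HN. lia. }
  assert (L5 := filterlim_comp _ _ _ _ _ _ _ _ L4 L3). clear L3 L4.
  assert (K : forall k : C, filterlim (fun _ : nat => k) eventually (locally k))
    by (intros; apply filterlim_const).
  (* [L6] and [L7] are limits of one and the same sequence: the normalisations agree because 4^(-z)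
     (2n)^(2z) = n^(2z) and the factors (2p + 5)! cancel. *)
  assert (L6 := filterlim_Cmult _ _ _ _
    (K (Cmult (CGamma z) (CGamma z))) (filterlim_Cmult _ _ _ _ L2 L5)).
  assert (L7 := filterlim_Cmult _ _ _ _ (K T) (filterlim_Cmult _ _ _ _ L1 L1)).
  rewrite !Cmult_1_r in L6, L7.
  refine (filterlim_locally_unique (V := C_R_NormedModule) _ _ _ L6 _).
  eapply filterlim_ext; [|exact L7].
  intros p. cbv beta.
  set (n := INR (p + 3)).
  assert (hn : 0 < n) by (apply lt_0_INR; lia).
  replace (INR (2 * p + 3 + 3)) with (2 * n).
  2:{ unfold n. rewrite !plus_INR, mult_INR. simpl. ring. }
  replace (2 * p + 3 + 2)%nat with (2 * p + 5)%nat by lia.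
  replace (Cplus (Cmult (RtoC 2) z) (RtoC (2 * n))) with (Cmult (RtoC 2) (Cplus z (RtoC n))) by
    (rewrite RtoC_mult; ring).
  assert (e1 := CGamma_shift z (p + 3) hz). assert (e2 := beta_gamma_shift z (p + 3) hz).
  fold n T in e1, e2. rewrite e1.
  set (P := poch z (p + 3)) in *.
  set (B := central_beta (Cplus z (RtoC n))) in *.
  set (G := CGamma (Cmult (RtoC 2) (Cplus z (RtoC n)))) in *.
  assert (e3 := Rcpow_duplication n z hn).
  assert (n1 := Rcpow_neq_0 (/ 4) z). assert (n2 := Rcpow_neq_0 (2 * n) (Cmult (RtoC 2) z)).
  assert (n3 := Rcpow_neq_0 n z).
  set (r4 := Rcpow (/ 4) z) in *. set (r2 := Rcpow (2 * n) _) in *. set (rn := Rcpow n z) in *.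
  assert (f1 := RtoC_neq_0 _ (INR_fact_neq_0 (p + 2))).
  assert (f2 := RtoC_neq_0 _ (INR_fact_neq_0 (2 * p + 5))).
  replace (RtoC (INR (fact (p + 2)) ^ 2 / INR (fact (2 * p + 5)))) with
    (Cdiv (Cmult (RtoC (INR (fact (p + 2)))) (RtoC (INR (fact (p + 2))))) (RtoC (INR (fact
      (2 * p + 5))))).
  2:{ rewrite <- RtoC_mult, <- RtoC_div by apply INR_fact_neq_0. f_equal. simpl. f_equal. ring. }
  set (F := RtoC (INR (fact (p + 2)))) in *. set (F' := RtoC (INR (fact (2 * p + 5)))) in *.
  match goal with |- ?a = ?b => change (@eq C a b) end.
  transitivity (Cdiv (Cmult (Cmult (CGamma z) (CGamma z)) (Cmult (Cmult P P) T)) (Cmult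
    (Cmult rn rn) (Cmult F F))).
  - field. auto.
  - rewrite <- e2, <- e3. field. auto.
Qed.

(** * Umbral binomial sums *)

(* [umbral m x p] is the binomial sum of C(m,n) x_n p^(m-n), that is (p + x)^m with x^n read as x_n. *)
Fixpoint umbral (m : nat) (x : nat -> C) (p : C) : C :=
  match m with
  | O => x O
  | S k => Cplus (Cmult p (umbral k x p)) (umbral k (fun n => x (S n)) p)
  end.

Lemma umbral_ext m : forall x y p, (forall n, (n <= m)%nat -> x n = y n) ->
  umbral m x p = umbral m y p.
Proof.
  induction m as [|m IH]; intros x y p h; simpl; [apply h; lia|].
  rewrite (IH x y), (IH (fun n => x (S n)) (fun n => y (S n))); auto; intros; apply h; lia.
Qed.

Lemma umbral_plus m : forall x y p,
  umbral m (fun n => Cplus (x n) (y n)) p = Cplus (umbral m x p) (umbral m y p).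
Proof.
  induction m as [|m IH]; intros x y p; simpl; auto.
  rewrite IH, (IH (fun n => x (S n))). ring.
Qed.

Lemma umbral_scal m k : forall x p,
  umbral m (fun n => Cmult k (x n)) p = Cmult k (umbral m x p).
Proof.
  induction m as [|m IH]; intros x p; simpl; auto.
  rewrite IH, (IH (fun n => x (S n))). ring.
Qed.

Lemma umbral_zero m p : forall x, (forall n, (n <= m)%nat -> x n = RtoC 0) ->
  umbral m x p = RtoC 0.
Proof.
  intros x h. rewrite (umbral_ext m x (fun n => Cmult (RtoC 0) (RtoC 0)) p).
  - rewrite (umbral_scal m (RtoC 0) (fun _ => RtoC 0)). ring.
  - intros n hn. rewrite h by auto. ring.
Qed.

Lemma umbral_first m : forall x,
  (forall n, (1 <= n <= m)%nat -> x n = RtoC 0) -> umbral m x (RtoC 1) = x O.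
Proof.
  induction m as [|m IH]; intros x h; auto.
  simpl. rewrite IH by (intros; apply h; lia).
  rewrite umbral_zero; [ring|]. intros; apply h; lia.
Qed.

(** Umbrally, ((p + q) + x)^m = (q + (p + x))^m: the umbral powers of p + x serve as the new
    sequence. *)
Lemma umbral_add m : forall x p q,
  umbral m x (Cplus p q) = umbral m (fun j => umbral j x p) q.
Proof.
  induction m as [|m IH]; intros x p q; auto.
  simpl. rewrite umbral_plus, umbral_scal, !IH. ring.
Qed.

Lemma umbral_scale m l : forall x p,
  umbral m (fun n => Cmult (Cpow l n) (x n)) (Cmult l p) = Cmult (Cpow l m) (umbral m x p).
Proof.
  induction m as [|m IH]; intros x p; auto.
  cbn [umbral]. rewrite IH.
  rewrite (umbral_ext m (fun n => Cmult (Cpow l (S n)) (x (S n)))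
    (fun n => Cmult l (Cmult (Cpow l n) (x (S n))))) by (intros; simpl; ring).
  rewrite umbral_scal, (IH (fun n => x (S n))). simpl. ring.
Qed.

(** The identity n C(m+1, n) = (m+1) C(m, n-1). *)
Lemma umbral_index m : forall x p,
  umbral (S m) (fun n => Cmult (RtoC (INR n)) (x n)) p =
  Cmult (RtoC (INR (S m))) (umbral m (fun n => x (S n)) p).
Proof.
  induction m as [|m IH]; intros x p.
  - simpl. ring.
  - change (umbral (S (S m)) ?X p) with
      (Cplus (Cmult p (umbral (S m) X p)) (umbral (S m) (fun n => X (S n)) p)).
    rewrite IH. cbv beta.
    rewrite (umbral_ext (S m) _ (fun n => Cplus (Cmult (RtoC (INR n)) (x (S n))) (x (S n)))).
    2:{ intros n _. rewrite S_INR, RtoC_plus. ring. }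
    rewrite umbral_plus, (IH (fun n => x (S n))), (S_INR (S m)), RtoC_plus. simpl umbral. ring.
Qed.

(** Appell property: the derivative of (p + x)^m in p is m (p + x)^(m-1); the sign comes from p = 1
    - t. At m = 0 the factor [INR m] vanishes, whatever [pred] returns. *)
Lemma is_Cderive_umbral m x t : is_Cderive (fun t => umbral m x (RtoC (1 - t))) t
  (Copp (Cmult (RtoC (INR m)) (umbral (pred m) x (RtoC (1 - t))))).
Proof.
  revert x. induction m as [|m IH]; intros x.
  - simpl. replace (Copp _) with (RtoC 0) by ring. apply is_Cderive_const.
  - simpl pred.
    assert (d := is_Cderive_plus _ _ t _ _
      (is_Cderive_mult (fun t => RtoC (1 - t)) _ t (RtoC (- (1))) _
         (is_Cderive_RtoC (fun t => 1 - t) t (- (1)) ltac:(auto_derive; auto; ring)) (IH x))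
      (IH (fun n => x (S n)))).
    cbv beta in d. rewrite S_INR, RtoC_plus.
    match type of d with is_Cderive _ _ ?v => replace (Copp _) with v; [exact d|] end.
    rewrite RtoC_opp. destruct m as [|m]; simpl; ring.
Qed.

Lemma poch_pred x n : poch (Cminus x (RtoC 1)) (S n) = Cmult (Cminus x (RtoC 1)) (poch x n).
Proof.
  induction n as [|n IH].
  - simpl. ring.
  - change (poch (Cminus x (RtoC 1)) (S (S n))) with
     (Cmult (poch (Cminus x (RtoC 1)) (S n)) (Cplus (Cminus x (RtoC 1)) (RtoC (INR (S n))))).
    rewrite IH, S_INR, RtoC_plus. simpl. ring.
Qed.

(** This is (-1)^n C(m, n). In the quotient form it matches the terms of [F21_special], and its
    Pascal rule matches the recursion of [umbral]. *)
Definition signed_binomial (m n : nat) : C := Cdiv (poch (RtoC (- INR m)) n) (RtoC (INR (fact n))).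

Lemma signed_binomial_pascal m n :
  signed_binomial (S m) (S n) = Cminus (signed_binomial m (S n)) (signed_binomial m n).
Proof.
  unfold signed_binomial.
  replace (RtoC (- INR (S m))) with (Cminus (RtoC (- INR m)) (RtoC 1)).
  2:{ rewrite S_INR, <- RtoC_minus. f_equal. ring. }
  rewrite poch_pred, fact_simpl, mult_INR, RtoC_mult.
  assert (f1 := RtoC_neq_0 _ (INR_fact_neq_0 n)).
  assert (f2 : RtoC (INR (S n)) <> RtoC 0) by (apply RtoC_neq_0, not_0_INR; lia).
  simpl poch. set (X := RtoC (- INR m)). rewrite S_INR, RtoC_plus in *. field. auto.
Qed.

Lemma signed_binomial_0 m : signed_binomial m 0 = RtoC 1.
Proof. unfold signed_binomial. simpl. field. Qed.

Lemma signed_binomial_over m : signed_binomial m (S m) = RtoC 0.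
Proof.
  unfold signed_binomial. simpl poch. rewrite <- RtoC_plus.
  replace (- INR m + INR m) with 0 by ring. unfold Cdiv. ring.
Qed.

Lemma Csum_ext f g m : (forall n, (n <= m)%nat -> f n = g n) -> Csum f m = Csum g m.
Proof.
  induction m as [|m IH]; intros h; simpl; [apply h; lia|].
  rewrite IH, h by (auto; intros; apply h; lia). auto.
Qed.

Lemma Csum_minus f g m : Csum (fun n => Cminus (f n) (g n)) m = Cminus (Csum f m) (Csum g m).
Proof. induction m as [|m IH]; simpl; auto. rewrite IH. ring. Qed.

Lemma Csum_shift f m : Csum f (S m) = Cplus (f O) (Csum (fun n => f (S n)) m).
Proof.
  induction m as [|m IH]; auto.
  change (Csum f (S (S m))) with (Cplus (Csum f (S m)) (f (S (S m)))). rewrite IH. simpl. ring.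
Qed.

Lemma Csum_signed_binomial m : forall y,
  Csum (fun n => Cmult (signed_binomial m n) (y n)) m =
  umbral m (fun n => Cmult (Cpow (Copp (RtoC 1)) n) (y n)) (RtoC 1).
Proof.
  induction m as [|m IH]; intros y.
  - simpl. rewrite signed_binomial_0. ring.
  - rewrite Csum_shift.
    rewrite (Csum_ext _ (fun n => Cminus (Cmult (signed_binomial m (S n)) (y (S n)))
      (Cmult (signed_binomial m n) (y (S n))))).
    2:{ intros n _. rewrite signed_binomial_pascal. ring. }
    rewrite Csum_minus, (IH (fun n => y (S n))).
    assert (e := Csum_shift (fun n => Cmult (signed_binomial m n) (y n)) m).
    simpl Csum in e at 1. rewrite signed_binomial_over, IH, signed_binomial_0 in e.
    rewrite signed_binomial_0. simpl umbral.
    rewrite (umbral_ext m (fun n => Cmult (Cmult (Copp (RtoC 1)) _) _)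
      (fun n => Cmult (Copp (RtoC 1)) (Cmult (Cpow (Copp (RtoC 1)) n) (y (S n))))).
    2:{ intros; simpl; ring. }
    rewrite umbral_scal.
    match type of e with Cplus ?u _ = Cplus _ ?v =>
      transitivity (Cplus (Cplus (Cmult (RtoC 1) (y O)) v) (Copp (umbral m (fun n => Cmult (Cpow
        (Copp (RtoC 1)) n) (y (S n))) (RtoC 1)))) end.
    + ring.
    + rewrite <- e. ring.
Qed.

(** * Rodrigues functions and orthogonality *)

(** The sign is the one split off from (-m)_n / n! = (-1)^n C(m, n), so that the hypergeometric
    polynomial becomes a plain binomial sum. *)
Definition jacobi_coef (b : C) (n : nat) : C :=
  Cmult (Cpow (Copp (RtoC 1)) n) (Cdiv (poch (Copp b) n) (poch (Copp (Cmult (RtoC 2) b)) n)).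

Lemma double_sub_neq_0 b m n : Re b > Rmax 0 (INR m - 1) -> (n < m)%nat ->
  Cminus (Cmult (RtoC 2) b) (RtoC (INR n)) <> RtoC 0.
Proof.
  intros hb hn. apply Re_neq_0.
  assert (h0 := Rmax_l 0 (INR m - 1)). assert (h1 := Rmax_r 0 (INR m - 1)).
  apply (le_INR (S _)) in hn. rewrite S_INR in hn. unfold Re in *; simpl. lra.
Qed.

Lemma poch_double_neq_0 b m n : Re b > Rmax 0 (INR m - 1) -> (n <= m)%nat ->
  poch (Copp (Cmult (RtoC 2) b)) n <> RtoC 0.
Proof.
  intros hb. induction n as [|n IH]; intros hn; simpl.
  - apply RtoC_neq_0; lra.
  - apply Cmult_neq_0; [apply IH; lia|]. intros e.
    apply (double_sub_neq_0 b m n hb hn).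
    transitivity (Copp (Cplus (Copp (Cmult (RtoC 2) b)) (RtoC (INR n)))); [ring|].
    rewrite e. ring.
Qed.

Lemma jacobi_coef_succ b m n : Re b > Rmax 0 (INR m - 1) -> (n < m)%nat ->
  Cmult (Cminus (Cmult (RtoC 2) b) (RtoC (INR n))) (jacobi_coef b (S n)) =
  Copp (Cmult (Cminus b (RtoC (INR n))) (jacobi_coef b n)).
Proof.
  intros hb hn. unfold jacobi_coef. simpl poch. simpl Cpow.
  assert (h1 := poch_double_neq_0 b m n hb ltac:(lia)).
  assert (h2 := double_sub_neq_0 b m n hb hn).
  assert (h3 : Cplus (Copp (Cmult (RtoC 2) b)) (RtoC (INR n)) <> RtoC 0).
  { intros e. apply h2. transitivity (Copp (Cplus (Copp (Cmult (RtoC 2) b)) (RtoC (INR n)))); [ring|].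
    rewrite e. ring. }
  field. auto.
Qed.

Lemma F21_special_umbral b m x : Re b > Rmax 0 (INR m - 1) ->
  F21_special b m x = umbral m (fun n => Cmult (Cpow (RtoC x) n) (jacobi_coef b n)) (RtoC 1).
Proof.
  intros hb. unfold F21_special.
  rewrite (Csum_ext _ (fun n => Cmult (signed_binomial m n) (Cmult (Cpow (RtoC x) n)
    (Cdiv (poch (Copp b) n) (poch (Copp (Cmult (RtoC 2) b)) n))))).
  - rewrite Csum_signed_binomial. apply umbral_ext. intros n _. unfold jacobi_coef. ring.
  - intros n hn. unfold signed_binomial. rewrite RtoC_pow.
    assert (h1 := poch_double_neq_0 b m n hb hn).
    assert (f1 := RtoC_neq_0 _ (INR_fact_neq_0 n)). field. auto.
Qed.

(** Sum the coefficient recurrence (2b - n) x_(n+1) + (b - n) x_n = 0 with the weights C(j, n)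
    v^(j-n), and remove the factors n by [umbral_index]. The result is exactly what closes
    [rodrigues] under differentiation. *)
Lemma umbral_jacobi_succ b m j v : Re b > Rmax 0 (INR m - 1) -> (j < m)%nat ->
  Cmult (Cminus (Cmult (RtoC 2) b) (RtoC (INR j))) (umbral (S j) (jacobi_coef b) v) =
  Cminus (Cmult (Cmult (Cminus b (RtoC (INR j))) (Cminus (Cmult (RtoC 2) v) (RtoC 1)))
       (umbral j (jacobi_coef b) v))
    (Cmult (Cmult (RtoC (INR j)) (Cmult v (Cminus (RtoC 1) v))) (umbral (pred j) (jacobi_coef b) v)).
Proof.
  intros hb hj. set (x := jacobi_coef b).
  assert (R : umbral j (fun n => Cplus
     (Cplus (Cmult (Cmult (RtoC 2) b) (x (S n))) (Cmult (Copp (RtoC 1)) (Cmult (RtoC (INR n)) (x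
       (S n)))))
     (Cplus (Cmult b (x n)) (Cmult (Copp (RtoC 1)) (Cmult (RtoC (INR n)) (x n))))) v = RtoC 0).
  { apply umbral_zero. intros n hn. assert (k := jacobi_coef_succ b m n hb ltac:(lia)). fold x in k.
    transitivity (Cplus (Cmult (Cminus (Cmult (RtoC 2) b) (RtoC (INR n))) (x (S n)))
      (Cmult (Cminus b (RtoC (INR n))) (x n))); [ring|]. rewrite k. ring. }
  rewrite !umbral_plus in R.
  rewrite (umbral_scal j (Cmult (RtoC 2) b) (fun n => x (S n))) in R.
  rewrite (umbral_scal j b x) in R.
  rewrite (umbral_scal j (Copp (RtoC 1)) (fun n => Cmult (RtoC (INR n)) (x n))) in R.
  rewrite (umbral_scal j (Copp (RtoC 1)) (fun n => Cmult (RtoC (INR n)) (x (S n)))) in R.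
  destruct j as [|i].
  - simpl in *.
    match type of R with ?X = _ => transitivity (Cplus X (Cmult (Cmult b (Cminus (Cmult
      (RtoC 2) v) (RtoC 1))) (x O))) end; [ring|].
    rewrite R. ring.
  - rewrite (umbral_index i x), (umbral_index i (fun n => x (S n))) in R.
    simpl pred. set (J := RtoC (INR (S i))) in *. simpl umbral in *.
    match type of R with ?X = _ => match goal with |- _ = ?r => transitivity (Cplus X r) end end;
    [ring|].
    rewrite R. ring.
Qed.

(* The Rodrigues form: up to a constant, the j-th derivative of (u (1 - u))^b. *)
Definition rodrigues (b : C) (j : nat) (u : R) : C :=
  Cmult (Rcpow (u * (1 - u)) (Cminus b (RtoC (INR j)))) (umbral j (jacobi_coef b) (RtoC (1 - u))).

(** Put v = 1 - u and let p_j be the umbral polynomial at v. The product rule gives (u(1 -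
    u))^(b-j-1) times (b - j)(2v - 1) p_j - j v (1 - v) p_(j-1), the right side of
    [umbral_jacobi_succ]. *)
Lemma is_Cderive_rodrigues b m j u : Re b > Rmax 0 (INR m - 1) -> (j < m)%nat -> 0 < u < 1 ->
  is_Cderive (rodrigues b j) u
    (Cmult (Cminus (Cmult (RtoC 2) b) (RtoC (INR j))) (rodrigues b (S j) u)).
Proof.
  intros hb hj hu.
  assert (hw : 0 < u * (1 - u)) by (apply Rmult_lt_0_compat; lra).
  set (z := Cminus b (RtoC (INR j))).
  assert (ez : Cminus b (RtoC (INR (S j))) = Cminus z (RtoC 1)).
  { unfold z. rewrite S_INR, RtoC_plus. ring. }
  assert (d := is_Cderive_mult _ _ u _ _ (is_Cderive_central_power z u hu)
    (is_Cderive_umbral j (jacobi_coef b) u)).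
  cbv beta in d. unfold rodrigues. fold z.
  match type of d with is_Cderive _ _ ?v => replace (Cmult _ _) with v; [exact d|] end.
  rewrite ez. set (W := Rcpow (u * (1 - u)) (Cminus z (RtoC 1))).
  replace (Rcpow (u * (1 - u)) z) with (Cmult W (RtoC (u * (1 - u)))).
  2:{ unfold W. rewrite <- (Rcpow_1 (u * (1 - u))) by lra. rewrite <- Rcpow_plus. f_equal. ring. }
  assert (k := umbral_jacobi_succ b m j (RtoC (1 - u)) hb hj).
  match goal with |- _ = Cmult ?X (Cmult W ?Y) => transitivity (Cmult W (Cmult X Y)); [|ring] end.
  rewrite k. fold z. rewrite RtoC_mult, !RtoC_minus, RtoC_mult. ring.
Qed.

(** The function (u(1 - u))^b is symmetric about 1/2, and each differentiation brings one sign. *)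
Lemma rodrigues_reflect b m j u : Re b > Rmax 0 (INR m - 1) -> (j <= m)%nat -> 0 < u < 1 ->
  rodrigues b j (1 - u) = Cmult (Cpow (Copp (RtoC 1)) j) (rodrigues b j u).
Proof.
  intros hb. revert u. induction j as [|j IH]; intros u hj hu.
  - unfold rodrigues. simpl. replace (1 - (1 - u)) with u by ring.
    rewrite (Rmult_comm (1 - u)). ring.
  - assert (h := double_sub_neq_0 b m j hb hj). set (k := Cminus _ _) in h.
    assert (d1 := is_Cderive_comp (rodrigues b j) (fun u => 1 - u) u _ (- (1))
      (is_Cderive_rodrigues b m j (1 - u) hb hj ltac:(lra)) ltac:(auto_derive; auto; ring)).
    assert (d2 := is_Cderive_mult (fun _ => Cpow (Copp (RtoC 1)) j) (rodrigues b j) u _ _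
      (is_Cderive_const _ _) (is_Cderive_rodrigues b m j u hb hj hu)).
    assert (l : locally u (fun t => Cmult (Cpow (Copp (RtoC 1)) j)
      (rodrigues b j t) = rodrigues b j (1 - t))).
    { assert (l0 : locally u (fun t => 0 < t < 1)).
      { apply (open_and (fun t => 0 < t) (fun t => t < 1));
        [apply open_gt | apply open_lt | exact hu]. }
      revert l0. apply filter_imp. intros t ht. symmetry. apply IH; auto; lia. }
    assert (e := is_Cderive_unique _ _ _ _ d1 (is_Cderive_ext_loc _ _ _ _ l d2)).
    fold k in e. rewrite RtoC_opp in e. simpl Cpow.
    transitivity (Cmult (Copp (Cinv k)) (Cmult (Copp (RtoC 1)) (Cmult k (rodrigues b (S j) (1 - u))))).
    + field. auto.
    + rewrite e. field. auto.
Qed.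

(** Stands for being a polynomial of degree less than j, without coefficients: integration by parts
    consumes one derivative at a time and ends at the zero function. *)
Fixpoint derivative_vanishes (j : nat) (f : R -> R) : Prop :=
  match j with
  | O => forall u, f u = 0
  | S k => exists df, (forall u, is_derive f u (df u)) /\ derivative_vanishes k df
  end.

Lemma derivative_vanishes_ext j : forall f g, (forall u, f u = g u) ->
  derivative_vanishes j f -> derivative_vanishes j g.
Proof.
  destruct j as [|j]; intros f g h; simpl.
  - intros hf u. now rewrite <- h.
  - intros [df [d hd]]. exists df. split; auto. intros u. now apply (is_derive_ext f).
Qed.

Lemma derivative_vanishes_succ j : forall f,
  derivative_vanishes j f -> derivative_vanishes (S j) f.
Proof.
  induction j as [|j IH]; intros f.
  - intros h. exists (fun _ => 0). split; [|simpl; auto].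
    intros u. apply (is_derive_ext (fun _ => 0)); [intros; symmetry; apply h|].
    apply (is_derive_const (V := R_NormedModule)).
  - intros [df [d hd]]. exists df. auto.
Qed.

Lemma derivative_vanishes_plus j : forall f g, derivative_vanishes j f ->
  derivative_vanishes j g -> derivative_vanishes j (fun u => f u + g u).
Proof.
  induction j as [|j IH]; intros f g.
  - simpl. intros hf hg u. rewrite hf, hg. ring.
  - intros [df [d hd]] [dg [d' hd']]. exists (fun u => df u + dg u). split; auto.
    intros u. now apply (is_derive_plus (V := R_NormedModule)).
Qed.

Lemma derivative_vanishes_scal j k : forall f, derivative_vanishes j f ->
  derivative_vanishes j (fun u => k * f u).
Proof.
  induction j as [|j IH]; intros f.
  - simpl. intros hf u. rewrite hf. ring.
  - intros [df [d hd]]. exists (fun u => k * df u). split; auto.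
    intros u. now apply is_derive_scal.
Qed.

Lemma derivative_vanishes_affine j p q : forall f, derivative_vanishes j f ->
  derivative_vanishes (S j) (fun u => (p * u + q) * f u).
Proof.
  induction j as [|j IH]; intros f hf.
  - apply derivative_vanishes_succ. simpl in *. intros u. rewrite hf. ring.
  - destruct hf as [df [d hd]]. exists (fun u => p * f u + (p * u + q) * df u). split.
    + intros u. apply (is_derive_mult (fun u => p * u + q) f u p (df u)); auto.
      * auto_derive; auto. ring.
      * intros; apply Rmult_comm.
    + apply derivative_vanishes_plus; auto.
      apply derivative_vanishes_scal. exists df; auto.
Qed.

Lemma derivative_vanishes_ex_derive j f u : derivative_vanishes j f -> ex_derive f u.
Proof.
  intros h. apply derivative_vanishes_succ in h. destruct h as [df [d _]]. now exists (df u).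
Qed.

Lemma bounded_on_unit (f : R -> C) : (forall t, 0 <= t <= 1 -> continuous f t) ->
  exists M, 0 <= M /\ forall t, 0 <= t <= 1 -> Cmod (f t) <= M.
Proof.
  intros h. destruct (bounded_continuity (V := C_R_NormedModule) f 0 1) as [M HM]; [exact h|].
  assert (H : forall t, 0 <= t <= 1 -> Cmod (f t) <= M).
  { intros t ht. rewrite Cmod_norm. left. now apply HM. }
  exists M. split; auto. assert (k := H 0 ltac:(lra)). assert (k' := Cmod_ge_0 (f 0)). lra.
Qed.

(** Integration by parts as a recursion on primitives: with V_j for [rodrigues b j], if F is a
    primitive of V_j f' then (V_j f - F)/(2b - j) is one of V_(j+1) f. *)
Lemma rodrigues_orthogonal_primitive b m j : Re b > Rmax 0 (INR m - 1) -> (j <= m)%nat ->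
  forall f, derivative_vanishes j f -> exists F : R -> C,
    (forall u, 0 < u < 1 -> is_Cderive F u (Cmult (rodrigues b j u) (RtoC (f u)))) /\
    filterlim F (at_right 0) (locally (RtoC 0)) /\ filterlim F (at_left 1) (locally (RtoC 0)).
Proof.
  intros hb. induction j as [|j IH]; intros hj f hf.
  - exists (fun _ => RtoC 0). split; [|split; apply filterlim_const].
    intros u _. simpl in hf. rewrite hf, Cmult_0_r. apply is_Cderive_const.
  - destruct hf as [df [d hd]].
    destruct (IH ltac:(lia) df hd) as [F [HF [l0 l1]]].
    assert (h := double_sub_neq_0 b m j hb hj). set (k := Cminus _ _) in h.
    set (g := fun u => Cmult (umbral j (jacobi_coef b) (RtoC (1 - u))) (RtoC (f u))).
    destruct (bounded_on_unit g) as [M [hM HM]].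
    { intros t _. apply continuous_Cmult.
      - eapply is_Cderive_continuous, is_Cderive_umbral.
      - apply continuous_RtoC, (ex_derive_continuous (V := R_NormedModule)). now exists (df t). }
    (* The lower bound m - 1 on Re b enters here: as j < m, the boundary term V_j f carries a
       positive power of u(1 - u) and vanishes at both ends. *)
    assert (ha : 0 < Re (Cminus b (RtoC (INR j)))).
    { assert (q := Rmax_r 0 (INR m - 1)). apply (le_INR (S _)) in hj. rewrite S_INR in hj.
      unfold Re in *; simpl. lra. }
    destruct (filterlim_central_power_zero (fun u => Cmult (rodrigues b j u) (RtoC (f u))) _ M ha hM)
      as [m0 m1].
    { intros u hu. unfold rodrigues. rewrite <- Cmult_assoc, Cmod_mult, Cmod_Rcpow, Rmult_comm.
      apply Rmult_le_compat_r; [left; apply exp_pos|]. apply (HM u). lra. }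
    assert (Z : RtoC 0 = Cmult (Cinv k) (Cplus (RtoC 0) (Cmult (Copp (RtoC 1)) (RtoC 0)))) by ring.
    exists (fun u => Cmult (Cinv k) (Cplus (Cmult (rodrigues b j u) (RtoC (f u)))
       (Cmult (Copp (RtoC 1)) (F u)))).
    split; [|split].
    + intros u hu.
      assert (d1 := is_Cderive_mult _ _ u _ _ (is_Cderive_rodrigues b m j u hb hj hu)
        (is_Cderive_RtoC _ _ _ (d u))).
      assert (d2 := is_Cderive_mult _ _ u _ _ (is_Cderive_const (Copp (RtoC 1)) u) (HF u hu)).
      assert (d3 := is_Cderive_mult _ _ u _ _ (is_Cderive_const (Cinv k) u)
        (is_Cderive_plus _ _ _ _ _ d1 d2)).
      cbv beta in d3. fold k in d3.
      match type of d3 with is_Cderive _ _ ?v => replace (Cmult (rodrigues b (S j) u) _) with v;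
      [exact d3|] end.
      field. auto.
    + rewrite Z. apply filterlim_Cmult; [apply filterlim_const|].
      apply filterlim_Cplus; auto. apply filterlim_Cmult; auto. apply filterlim_const.
    + rewrite Z. apply filterlim_Cmult; [apply filterlim_const|].
      apply filterlim_Cplus; auto. apply filterlim_Cmult; auto. apply filterlim_const.
Qed.

Lemma continuous_rodrigues b j u : 0 < u < 1 -> continuous (rodrigues b j) u.
Proof.
  intros hu. apply continuous_Cmult.
  - eapply is_Cderive_continuous, is_Cderive_central_power, hu.
  - eapply is_Cderive_continuous, is_Cderive_umbral.
Qed.

Lemma rodrigues_orthogonal b m j f : Re b > Rmax 0 (INR m - 1) -> (j <= m)%nat ->
  derivative_vanishes j f ->
  is_RInt_gen (fun u => Cmult (rodrigues b j u) (RtoC (f u))) (at_right 0) (at_left 1) (RtoC 0).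
Proof.
  intros hb hj hf.
  destruct (rodrigues_orthogonal_primitive b m j hb hj f hf) as [F [HF [l0 l1]]].
  replace (RtoC 0) with (Cminus (RtoC 0) (RtoC 0)) by ring.
  apply (is_RInt_gen_Cantiderivative unit_ends F); auto.
  intros u hu. apply continuous_Cmult; [now apply continuous_rodrigues|].
  apply continuous_RtoC, (ex_derive_continuous (V := R_NormedModule)).
  now apply (derivative_vanishes_ex_derive j).
Qed.

(** The Lucas sequence U_k, that is (x^k - y^k)/(x - y) for s = x + y and p = x y, in a
    division-free form that is visibly polynomial in s and p. *)
Fixpoint lucas (s p : R) (k : nat) : R :=
  match k with
  | O => 0
  | S k' => match k' with
            | O => 1
            | S k'' => s * lucas s p k' - p * lucas s p k''
            end
  end.

Lemma lucas_binet x y k : (x - y) * lucas (x + y) (x * y) k = x ^ k - y ^ k.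
Proof.
  enough ((x - y) * lucas (x + y) (x * y) k = x ^ k - y ^ k /\
          (x - y) * lucas (x + y) (x * y) (S k) = x ^ S k - y ^ S k) by tauto.
  induction k as [|k [IH1 IH2]].
  - simpl; split; ring.
  - split; auto.
    change (lucas (x + y) (x * y) (S (S k))) with
      ((x + y) * lucas (x + y) (x * y) (S k) - x * y * lucas (x + y) (x * y) k).
    transitivity ((x + y) * ((x - y) * lucas (x + y) (x * y) (S k)) -
      x * y * ((x - y) * lucas (x + y) (x * y) k)); [ring|].
    rewrite IH1, IH2. simpl. ring.
Qed.

(** With s affine and p quadratic in u, U_k has degree at most k - 1. Two consecutive indices go
    through the induction because the recursion has order two. *)
Lemma lucas_derivative_vanishes s p k :
  derivative_vanishes k (fun u => lucas (s * (1 - 2 * u)) (p * (u * (1 - u))) k).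
Proof.
  set (f := fun k u => lucas (s * (1 - 2 * u)) (p * (u * (1 - u))) k).
  enough (derivative_vanishes k (f k) /\ derivative_vanishes (S k) (f (S k))) by tauto.
  induction k as [|k [IH1 IH2]].
  - split; [simpl; auto|]. exists (fun _ => 0). split; [|simpl; auto].
    intros u. apply (is_derive_const (V := R_NormedModule)).
  - split; auto.
    apply (derivative_vanishes_ext _
      (fun u => (-2 * s * u + s) * f (S k) u + (- p * u + 0) * ((-1 * u + 1) * f k u))).
    + intros u. unfold f. change (lucas ?a ?b (S (S k))) with (a * lucas a b
        (S k) - b * lucas a b k). ring.
    + apply derivative_vanishes_plus; [now apply derivative_vanishes_affine|].
      now apply derivative_vanishes_affine, derivative_vanishes_affine.
Qed.

Lemma is_RInt_gen_umbral {Fa Fb} {FFa : Filter Fa} {FFb : Filter Fb} m :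
  forall (g : nat -> R -> C) (I : nat -> C),
  (forall n, (n <= m)%nat -> is_RInt_gen (g n) Fa Fb (I n)) ->
  is_RInt_gen (fun t => umbral m (fun n => g n t) (RtoC 1)) Fa Fb (umbral m I (RtoC 1)).
Proof.
  induction m as [|m IH]; intros g I h; simpl; [apply h; lia|].
  apply is_RInt_gen_Cplus.
  - apply is_RInt_gen_Cmult, IH. intros; apply h; lia.
  - apply (IH (fun n => g (S n)) (fun n => I (S n))). intros; apply h; lia.
Qed.

Lemma continuous_umbral m : forall (g : nat -> R -> C) (p : C) t,
  (forall n, (n <= m)%nat -> continuous (g n) t) ->
  continuous (fun t => umbral m (fun n => g n t) p) t.
Proof.
  induction m as [|m IH]; intros g p t h; simpl; [apply h; lia|].
  apply continuous_Cplus.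
  - apply continuous_Cmult; [apply continuous_const|]. apply IH. intros; apply h; lia.
  - apply (IH (fun n => g (S n))). intros; apply h; lia.
Qed.

(** * The involution *)

(** Continuity yields only a two-sided neighbourhood; the range condition puts the image on the
    inner side, as the one-sided filter demands. *)
Lemma filterlim_to_left_end (s : R -> R) F : ProperFilter F ->
  F (fun t => 0 < s t < 1) -> filterlim s F (locally 0) -> filterlim s F (at_right 0).
Proof.
  intros PF h l P [eps HP]. assert (c := l _ (locally_ball 0 eps)). unfold filtermap in *.
  generalize (filter_and _ _ h c). apply filter_imp. intros t [h1 h2]. apply HP; auto. lra.
Qed.

Lemma filterlim_to_right_end (s : R -> R) F : ProperFilter F ->
  F (fun t => 0 < s t < 1) -> filterlim s F (locally 1) -> filterlim s F (at_left 1).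
Proof.
  intros PF h l P [eps HP]. assert (c := l _ (locally_ball 1 eps)). unfold filtermap in *.
  generalize (filter_and _ _ h c). apply filter_imp. intros t [h1 h2]. apply HP; auto. lra.
Qed.

Lemma filterlim_derivable_left (s : R -> R) : ex_derive s 0 ->
  filterlim s (at_right 0) (locally (s 0)).
Proof.
  intros h. eapply filterlim_filter_le_1; [apply filter_le_within|].
  now apply (ex_derive_continuous (V := R_NormedModule) s).
Qed.

Lemma filterlim_derivable_right (s : R -> R) : ex_derive s 1 ->
  filterlim s (at_left 1) (locally (s 1)).
Proof.
  intros h. eapply filterlim_filter_le_1; [apply filter_le_within|].
  now apply (ex_derive_continuous (V := R_NormedModule) s).
Qed.

(* With P, Q, S the three positive quantities of the theorem, S = (1 - t) P + t Q, so that
   u = t Q / S satisfies 1 - u = (1 - t) P / S. On s = a + t the map [flip] is a Moebius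
   involution of [a, a + 1] that exchanges the ends and sends u to 1 - u; [root1] is carried
   to [root2] by it. *)
Definition fP (a c t : R) := c - a * (a + t).
Definition fQ (a c t : R) := c - (a + 1) * (a + t).
Definition fS (a c t : R) := c - (a + t) ^ 2.
Definition fM (a c t : R) := (1 - t) * (c - a ^ 2) + t * (c - (a + 1) ^ 2).
Definition uvar (a c t : R) := t * fQ a c t / fS a c t.
Definition flip (a c t : R) := (1 - t) * (c - a ^ 2) / fM a c t.
Definition uvar' (a c t : R) :=
  ((c - a ^ 2) * (1 - t) * fQ a c t + (c - (a + 1) ^ 2) * t * fP a c t) / fS a c t ^ 2.
Definition flip' (a c t : R) := - ((c - a ^ 2) * (c - (a + 1) ^ 2) / fM a c t ^ 2).
Definition root1 (a c t : R) := (1 - t) * fQ a c t / fS a c t.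
Definition root2 (a c t : R) := (c - (a + 1) ^ 2) / (c - a ^ 2) * (t * fP a c t / fS a c t).

Record admissible (a c : R) : Prop := {
  adm_P : forall t, 0 <= t <= 1 -> 0 < fP a c t;
  adm_Q : forall t, 0 <= t <= 1 -> 0 < fQ a c t;
  adm_S : forall t, 0 <= t <= 1 -> 0 < fS a c t;
  adm_A : 0 < c - a ^ 2;
  adm_K : 0 < c - (a + 1) ^ 2 }.

Lemma admissible_of a c : (forall t, 0 <= t <= 1 -> c - a * (a + t) > 0) ->
  (forall t, 0 <= t <= 1 -> c - (a + 1) * (a + t) > 0) ->
  (forall t, 0 <= t <= 1 -> c - (a + t) ^ 2 > 0) -> admissible a c.
Proof.
  intros h1 h2 h3. split; unfold fP, fQ, fS; intros; try (apply Rgt_lt; auto).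
  - assert (k := h3 0 ltac:(lra)). rewrite Rplus_0_r in k. lra.
  - assert (k := h3 1 ltac:(lra)). lra.
Qed.

Lemma fM_pos a c t : admissible a c -> 0 <= t <= 1 -> 0 < fM a c t.
Proof. intros [_ _ _ hA hK] ht. unfold fM.
  destruct (Rle_lt_or_eq_dec 0 t) as [h|h]; [lra| |subst; lra].
  assert (0 <= (1 - t) * (c - a ^ 2)) by (apply Rmult_le_pos; lra).
  assert (0 < t * (c - (a + 1) ^ 2)) by now apply Rmult_lt_0_compat. lra.
Qed.

Lemma fS_split a c t : fS a c t = (1 - t) * fP a c t + t * fQ a c t.
Proof. unfold fS, fP, fQ. ring. Qed.

Lemma one_sub_uvar a c t : admissible a c -> 0 <= t <= 1 ->
  1 - uvar a c t = (1 - t) * fP a c t / fS a c t.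
Proof.
  intros h ht. assert (hS := adm_S _ _ h t ht). unfold uvar.
  transitivity ((fS a c t - t * fQ a c t) / fS a c t); [field; lra|].
  rewrite (fS_split a c t) at 1. f_equal. ring.
Qed.

Lemma uvar_range a c t : admissible a c -> 0 < t < 1 -> 0 < uvar a c t < 1.
Proof.
  intros h ht. assert (ht' : 0 <= t <= 1) by lra.
  assert (hP := adm_P _ _ h t ht'). assert (hQ := adm_Q _ _ h t ht'). assert (hS := adm_S _ _ h t ht').
  assert (k := one_sub_uvar a c t h ht').
  assert (0 < uvar a c t).
  { apply Rdiv_lt_0_compat; auto. apply Rmult_lt_0_compat; lra. }
  assert (0 < (1 - t) * fP a c t / fS a c t).
  { apply Rdiv_lt_0_compat; auto. apply Rmult_lt_0_compat; lra. }
  lra.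
Qed.

Lemma one_sub_flip a c t : admissible a c -> 0 <= t <= 1 ->
  1 - flip a c t = t * (c - (a + 1) ^ 2) / fM a c t.
Proof.
  intros h ht. assert (hM := fM_pos a c t h ht). unfold flip.
  transitivity ((fM a c t - (1 - t) * (c - a ^ 2)) / fM a c t); [field; lra|].
  f_equal. unfold fM. ring.
Qed.

Lemma flip_range a c t : admissible a c -> 0 < t < 1 -> 0 < flip a c t < 1.
Proof.
  intros h ht. assert (ht' : 0 <= t <= 1) by lra. assert (hM := fM_pos a c t h ht').
  assert (hA := adm_A _ _ h). assert (hK := adm_K _ _ h).
  assert (k := one_sub_flip a c t h ht').
  assert (0 < flip a c t).
  { apply Rdiv_lt_0_compat; auto. apply Rmult_lt_0_compat; lra. }
  assert (0 < t * (c - (a + 1) ^ 2) / fM a c t).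
  { apply Rdiv_lt_0_compat; auto. apply Rmult_lt_0_compat; lra. }
  lra.
Qed.

Lemma fQ_flip a c t : fM a c t <> 0 ->
  fQ a c (flip a c t) = (c - (a + 1) ^ 2) * fP a c t / fM a c t.
Proof. unfold fP, fQ, flip, fM. intros h. field. auto. Qed.

(** Together with the formula for [flip'] this says that dt/S only changes sign under the
    involution. *)
Lemma fS_flip a c t : fM a c t <> 0 ->
  fS a c (flip a c t) = (c - a ^ 2) * (c - (a + 1) ^ 2) * fS a c t / fM a c t ^ 2.
Proof. unfold fS, flip, fM. intros h. field. auto. Qed.

Lemma uvar_flip a c t : admissible a c -> 0 < t < 1 ->
  uvar a c (flip a c t) = 1 - uvar a c t.
Proof.
  intros h ht. assert (ht' : 0 <= t <= 1) by lra. assert (hM := fM_pos a c t h ht').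
  assert (hA := adm_A _ _ h). assert (hK := adm_K _ _ h). assert (hS := adm_S _ _ h t ht').
  rewrite one_sub_uvar by auto. unfold uvar.
  rewrite fQ_flip, fS_flip by lra. unfold flip. field. repeat split; lra.
Qed.

Lemma root1_flip a c t : admissible a c -> 0 < t < 1 ->
  root1 a c (flip a c t) = root2 a c t.
Proof.
  intros h ht. assert (ht' : 0 <= t <= 1) by lra. assert (hM := fM_pos a c t h ht').
  assert (hA := adm_A _ _ h). assert (hK := adm_K _ _ h). assert (hS := adm_S _ _ h t ht').
  unfold root1, root2. rewrite one_sub_flip by auto.
  rewrite fQ_flip, fS_flip by lra. field. repeat split; lra.
Qed.

Lemma is_derive_uvar a c t : fS a c t <> 0 -> is_derive (uvar a c) t (uvar' a c t).
Proof.
  unfold uvar, uvar', fS, fQ, fP. intros h. auto_derive; auto. simpl. field.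
  intros e. apply h. lra.
Qed.

Lemma is_derive_flip a c t : fM a c t <> 0 -> is_derive (flip a c) t (flip' a c t).
Proof.
  unfold flip, flip', fM. intros h. auto_derive; auto. field. repeat split; auto.
Qed.

Lemma ex_derive_uvar' a c t : fS a c t <> 0 -> ex_derive (uvar' a c) t.
Proof.
  unfold uvar', fS, fQ, fP. intros h. auto_derive. repeat split; auto.
Qed.

Lemma ex_derive_flip' a c t : fM a c t <> 0 -> ex_derive (flip' a c) t.
Proof.
  unfold flip', fM. intros h. auto_derive. repeat split; auto.
Qed.

(** Source of du: it expresses 1/S as du/dt divided by (c - a^2)(r + r'), where r and r' are the two
    roots. *)
Lemma root_sum a c t : admissible a c -> 0 <= t <= 1 ->
  root1 a c t + root2 a c t = uvar' a c t * fS a c t / (c - a ^ 2).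
Proof.
  intros h ht. assert (hA := adm_A _ _ h). assert (hS := adm_S _ _ h t ht).
  unfold root1, root2, uvar'. field. lra.
Qed.

(** Gives, with [root_product], the sum and product of r and - r' as polynomials in u of degree 1
    and 2: the arguments later fed to [lucas]. *)
Lemma root_difference a c t : admissible a c -> 0 <= t <= 1 ->
  root1 a c t + - root2 a c t = (c - a * (a + 1)) / (c - a ^ 2) * (1 - 2 * uvar a c t).
Proof.
  intros h ht. assert (hA := adm_A _ _ h). assert (hS := adm_S _ _ h t ht).
  transitivity (((c - a ^ 2) * (1 - t) * fQ a c t - (c - (a + 1) ^ 2) * t * fP a c t) /
    (fS a c t * (c - a ^ 2))); [unfold root1, root2; field; lra|].
  transitivity ((c - a * (a + 1)) * (fS a c t - 2 * t * fQ a c t) / (fS a c t * (c - a ^ 2)));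
    [|unfold uvar; field; lra].
  f_equal. unfold fS, fP, fQ. ring.
Qed.

Lemma root_product a c t : admissible a c -> 0 <= t <= 1 ->
  root1 a c t * root2 a c t =
  (c - (a + 1) ^ 2) / (c - a ^ 2) * (uvar a c t * (1 - uvar a c t)).
Proof.
  intros h ht. assert (hA := adm_A _ _ h). assert (hS := adm_S _ _ h t ht).
  rewrite one_sub_uvar by auto. unfold root1, root2, uvar. field. lra.
Qed.

Lemma roots_pos a c t : admissible a c -> 0 < t < 1 -> 0 < root1 a c t /\ 0 < root2 a c t.
Proof.
  intros h ht. assert (ht' : 0 <= t <= 1) by lra. assert (hA := adm_A _ _ h).
  assert (hK := adm_K _ _ h).
  assert (hP := adm_P _ _ h t ht'). assert (hQ := adm_Q _ _ h t ht'). assert (hS := adm_S _ _ h t ht').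
  split; unfold root1, root2; repeat (first [apply Rdiv_lt_0_compat | apply Rmult_lt_0_compat]); lra.
Qed.

Lemma filterlim_uvar a c : admissible a c ->
  filterlim (uvar a c) (at_right 0) (at_right 0) /\ filterlim (uvar a c) (at_left 1) (at_left 1).
Proof.
  intros h. assert (h0 := adm_S _ _ h 0 ltac:(lra)). assert (h1 := adm_S _ _ h 1 ltac:(lra)).
  assert (e0 : uvar a c 0 = 0) by (unfold uvar; field; lra).
  assert (e1 : uvar a c 1 = 1).
  { assert (k := one_sub_uvar a c 1 h ltac:(lra)).
    replace ((1 - 1) * fP a c 1 / fS a c 1) with 0 in k by (field; lra). lra. }
  split.
  - apply filterlim_to_left_end; [typeclasses eauto| |].
    + generalize (ends_left _ _ _ unit_ends). apply filter_imp. intros; now apply uvar_range.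
    + assert (l := filterlim_derivable_left (uvar a c)). rewrite e0 in l. apply l.
      eexists; apply is_derive_uvar; lra.
  - apply filterlim_to_right_end; [typeclasses eauto| |].
    + generalize (ends_right _ _ _ unit_ends). apply filter_imp. intros; now apply uvar_range.
    + assert (l := filterlim_derivable_right (uvar a c)). rewrite e1 in l. apply l.
      eexists; apply is_derive_uvar; lra.
Qed.

Lemma filterlim_flip a c : admissible a c ->
  filterlim (flip a c) (at_right 0) (at_left 1) /\ filterlim (flip a c) (at_left 1) (at_right 0).
Proof.
  intros h. assert (h0 := fM_pos a c 0 h ltac:(lra)). assert (h1 := fM_pos a c 1 h ltac:(lra)).
  assert (e0 : flip a c 0 = 1).
  { assert (k := one_sub_flip a c 0 h ltac:(lra)).
    replace (0 * (c - (a + 1) ^ 2) / fM a c 0) with 0 in k by (field; lra). lra. }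
  assert (e1 : flip a c 1 = 0) by (unfold flip; field; lra).
  split.
  - apply filterlim_to_right_end; [typeclasses eauto| |].
    + generalize (ends_left _ _ _ unit_ends). apply filter_imp. intros; now apply flip_range.
    + assert (l := filterlim_derivable_left (flip a c)). rewrite e0 in l. apply l.
      eexists; apply is_derive_flip; lra.
  - apply filterlim_to_left_end; [typeclasses eauto| |].
    + generalize (ends_right _ _ _ unit_ends). apply filter_imp. intros; now apply flip_range.
    + assert (l := filterlim_derivable_right (flip a c)). rewrite e1 in l. apply l.
      eexists; apply is_derive_flip; lra.
Qed.

(** * The folded integral *)

(** The part of the integrand that is continuous on the closed interval and hence bounded; all
    singular behaviour is left to the powers of t and 1 - t. The nesting is that of the integrand in
    the theorem, so the two agree by conversion. *)
Definition regular_factor (m : nat) (beta : C) (e a c t : R) : C :=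
  Cmult
    (Cmult
       (Cdiv (Cmult (Rcpow (c - a * (a + t)) beta)
                    (Rcpow (c - (a + 1) * (a + t)) (Cminus beta (RtoC 1))))
             (Rcpow (c - (a + t) ^ 2) (Cmult (RtoC 2) beta)))
       (F21_special beta m ((c - (a + t) ^ 2) / ((c - a * (a + t)) * (1 - e * t)))))
    (RtoC (((1 - e * t) / (1 - e)) ^ m)).

Definition integrand (m : nat) (beta : C) (e a c t : R) : C :=
  Cmult (Cmult (regular_factor m beta e a c t) (Rcpow t (Cminus beta (RtoC (INR m)))))
    (Rcpow (1 - t) (Cminus beta (RtoC 1))).

Lemma Rcpow_minus_nat x z n : 0 < x ->
  Rcpow x (Cminus z (RtoC (INR n))) = Cdiv (Rcpow x z) (RtoC (x ^ n)).
Proof. intros hx. unfold Cminus. now rewrite Rcpow_plus, Rcpow_opp, Rcpow_nat. Qed.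

Lemma Rcpow_minus_1 x z : 0 < x -> Rcpow x (Cminus z (RtoC 1)) = Cdiv (Rcpow x z) (RtoC x).
Proof. intros hx. unfold Cminus. now rewrite Rcpow_plus, Rcpow_opp, Rcpow_1. Qed.

Lemma Rcpow_double x z : Rcpow x (Cmult (RtoC 2) z) = Cmult (Rcpow x z) (Rcpow x z).
Proof.
  rewrite <- Rcpow_plus. f_equal.
  rewrite RtoC_2. ring.
Qed.

Lemma one_sub_mul_pos e t : e < 1 -> 0 <= t <= 1 -> 0 < 1 - e * t.
Proof.
  intros he ht. destruct (Rle_dec e 0) as [h|h].
  - assert (e * t <= 0 * t) by (apply Rmult_le_compat_r; lra). lra.
  - assert (e * t <= e * 1) by (apply Rmult_le_compat_l; lra). lra.
Qed.

(* With z = S/P and y = 1 - e, the factor 1 - et = (1 - t) + yt splits umbrally, and 1 - t = z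
  (1 - u). *)
Lemma F21_special_expand m b e a c t : Re b > Rmax 0 (INR m - 1) -> admissible a c ->
  e < 1 -> 0 < t < 1 ->
  Cmult (F21_special b m (fS a c t / (fP a c t * (1 - e * t)))) (RtoC (((1 - e * t) / (1 - e)) ^ m)) =
  Cmult (RtoC (t ^ m)) (umbral m (fun j =>
    Cmult (Cpow (RtoC (fS a c t / fP a c t / ((1 - e) * t))) j)
      (umbral j (jacobi_coef b) (RtoC (1 - uvar a c t)))) (RtoC 1)).
Proof.
  intros hb h he ht. assert (ht' : 0 <= t <= 1) by lra.
  assert (hP := adm_P _ _ h t ht'). assert (hS := adm_S _ _ h t ht').
  assert (ou := one_sub_uvar a c t h ht').
  assert (hq := one_sub_mul_pos e t he ltac:(lra)).
  set (x := jacobi_coef b). set (y := 1 - e). set (z := fS a c t / fP a c t). set (q := 1 - e * t) in *.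
  assert (hy : 0 < y) by (unfold y; lra).
  assert (hyt : 0 < y * t) by (apply Rmult_lt_0_compat; lra).
  rewrite F21_special_umbral by auto. fold x.
  assert (e1 : Cmult (Cpow (RtoC q) m)
     (umbral m (fun n => Cmult (Cpow (RtoC (fS a c t / (fP a c t * q))) n) (x n)) (RtoC 1)) =
     umbral m (fun n => Cmult (Cpow (RtoC z) n) (x n)) (RtoC q)).
  { rewrite <- umbral_scale, Cmult_1_r. apply umbral_ext. intros n _.
    rewrite Cmult_assoc, <- Cpow_mult_l, <- RtoC_mult. do 3 f_equal. unfold z. field. lra. }
  assert (e2 : umbral m (fun n => Cmult (Cpow (RtoC z) n) (x n)) (RtoC q) =
     Cmult (Cpow (RtoC (y * t)) m) (umbral m (fun j => Cmult (Cpow (RtoC (z / (y * t))) j)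
      (umbral j x (RtoC (1 - uvar a c t)))) (RtoC 1))).
  { replace q with ((1 - t) + y * t) by (unfold q, y; ring).
    rewrite RtoC_plus, umbral_add.
    rewrite <- (Cmult_1_r (RtoC (y * t))) at 1.
    rewrite <- umbral_scale. apply umbral_ext. intros j _.
    rewrite Cmult_assoc, <- Cpow_mult_l, <- RtoC_mult.
    replace (y * t * (z / (y * t))) with z by (field; lra).
    rewrite <- umbral_scale. f_equal. rewrite <- RtoC_mult. f_equal.
    rewrite ou. unfold z. field. lra. }
  transitivity (Cmult (RtoC (/ y ^ m)) (Cmult (Cpow (RtoC q) m)
     (umbral m (fun n => Cmult (Cpow (RtoC (fS a c t / (fP a c t * q))) n) (x n)) (RtoC 1)))).
  - unfold Rdiv at 2. rewrite Rpow_mult_distr, RtoC_mult, pow_inv, <- !RtoC_pow. ring.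
  - rewrite e1, e2. rewrite Cmult_assoc, <- !RtoC_pow, <- !RtoC_mult. do 2 f_equal.
    rewrite Rpow_mult_distr. field. apply pow_nonzero. lra.
Qed.

(** Since u(1 - u) S^2 = t Q (1 - t) P, the powers with exponent beta merge into (u(1 - u))^beta,
    and t^m cancels. There remains 1/((1 - t) Q) = 1/(r S), and each factor S/(P y t) equals r/(y
    u(1 - u)), which lowers the exponent by one. *)
Lemma integrand_expand m b e a c t : Re b > Rmax 0 (INR m - 1) -> admissible a c ->
  e < 1 -> 0 < t < 1 ->
  integrand m b e a c t =
  Cmult (RtoC (/ (root1 a c t * fS a c t)))
   (umbral m (fun j => Cmult (RtoC ((root1 a c t / (1 - e)) ^ j)) (rodrigues b j (uvar a c t)))
     (RtoC 1)).
Proof.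
  intros hb h he ht. assert (ht' : 0 <= t <= 1) by lra.
  assert (hP := adm_P _ _ h t ht'). assert (hQ := adm_Q _ _ h t ht'). assert (hS := adm_S _ _ h t ht').
  assert (hu := uvar_range a c t h ht). assert (ou := one_sub_uvar a c t h ht').
  assert (hw : 0 < uvar a c t * (1 - uvar a c t)) by (apply Rmult_lt_0_compat; lra).
  set (w := uvar a c t * (1 - uvar a c t)) in *.
  unfold integrand, regular_factor.
  fold (fP a c t) (fQ a c t) (fS a c t).
  rewrite <- (Cmult_assoc (Cdiv _ _)), (F21_special_expand m b e a c t) by auto.
  set (G := fun j => Cmult (Cpow (RtoC (fS a c t / fP a c t / ((1 - e) * t))) j)
      (umbral j (jacobi_coef b) (RtoC (1 - uvar a c t)))).
  rewrite (umbral_ext m (fun j => Cmult (RtoC ((root1 a c t / (1 - e)) ^ j)) _)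
    (fun j => Cmult (Rcpow w b) (G j))).
  2:{ intros j _. unfold G, rodrigues. fold w. rewrite Rcpow_minus_nat by auto.
      replace (root1 a c t / (1 - e)) with (w * (fS a c t / fP a c t / ((1 - e) * t))).
      2:{ unfold w, root1. rewrite ou. unfold uvar. field. lra. }
      rewrite Rpow_mult_distr, RtoC_mult, <- RtoC_pow.
      assert (RtoC (w ^ j) <> RtoC 0) by (apply RtoC_neq_0, pow_nonzero; lra). field. auto. }
  rewrite umbral_scal.
  assert (ew : Cmult (Rcpow w b) (Cmult (Rcpow (fS a c t) b) (Rcpow (fS a c t) b)) =
    Cmult (Cmult (Rcpow t b) (Rcpow (fQ a c t) b)) (Cmult (Rcpow (1 - t) b) (Rcpow (fP a c t) b))).
  { rewrite <- !Rcpow_mult by (auto; repeat apply Rmult_lt_0_compat; lra).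
    f_equal. unfold w. rewrite ou. unfold uvar. field. lra. }
  rewrite Rcpow_minus_nat, !Rcpow_minus_1, Rcpow_double by lra.
  replace (root1 a c t * fS a c t) with ((1 - t) * fQ a c t) by (unfold root1; field; lra).
  rewrite RtoC_inv, RtoC_mult by (apply Rgt_not_eq, Rmult_lt_0_compat; lra).
  assert (n1 := Rcpow_neq_0 (fS a c t) b).
  assert (n2 : RtoC (fQ a c t) <> RtoC 0) by (apply RtoC_neq_0; lra).
  assert (n3 : RtoC (1 - t) <> RtoC 0) by (apply RtoC_neq_0; lra).
  assert (n4 : RtoC (t ^ m) <> RtoC 0) by (apply RtoC_neq_0, pow_nonzero; lra).
  set (U := umbral m G (RtoC 1)).
  set (Sb := Rcpow (fS a c t) b) in *. set (Qb := Rcpow (fQ a c t) b) in *.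
  set (Pb := Rcpow (fP a c t) b) in *. set (tb := Rcpow t b) in *. set (ob := Rcpow (1 - t) b) in *.
  replace (Rcpow w b) with (Cdiv (Cmult (Cmult tb Qb) (Cmult ob Pb)) (Cmult Sb Sb)).
  2:{ rewrite <- ew. field. auto. }
  field. auto.
Qed.

Lemma continuous_regular_factor m b e a c : Re b > Rmax 0 (INR m - 1) -> e < 1 ->
  admissible a c -> forall t, 0 <= t <= 1 -> continuous (regular_factor m b e a c) t.
Proof.
  intros hb he h t ht.
  assert (hP := adm_P _ _ h t ht). assert (hQ := adm_Q _ _ h t ht). assert (hS := adm_S _ _ h t ht).
  assert (hq := one_sub_mul_pos e t he ltac:(lra)). unfold fP, fQ, fS in *.
  assert (pw : forall (f : R -> R) z, ex_derive f t -> 0 < f t -> continuous (fun t => Rcpow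
    (f t) z) t).
  { intros f z [l hl] hf. eapply is_Cderive_continuous.
    apply (is_Cderive_comp (fun w => Rcpow w z) f); [now apply is_Cderive_Rcpow | exact hl]. }
  assert (rc : forall f : R -> R, ex_derive f t -> continuous (fun t => RtoC (f t)) t).
  { intros f hf. now apply continuous_RtoC, (ex_derive_continuous (V := R_NormedModule)). }
  unfold regular_factor. apply continuous_Cmult; [apply continuous_Cmult|].
  - apply (continuous_ext (fun t => Cmult (Cmult (Rcpow (c - a * (a + t)) b)
       (Rcpow (c - (a + 1) * (a + t)) (Cminus b (RtoC 1))))
       (Rcpow (c - (a + t) ^ 2) (Copp (Cmult (RtoC 2) b))))).
    { intros s. now rewrite Rcpow_opp. }
    apply continuous_Cmult; [apply continuous_Cmult|]; apply pw; auto; auto_derive; auto.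
  - apply (continuous_ext (fun t => umbral m (fun n => Cmult
      (RtoC (((c - (a + t) ^ 2) / ((c - a * (a + t)) * (1 - e * t))) ^ n)) (jacobi_coef b n))
        (RtoC 1))).
    { intros s. rewrite F21_special_umbral by auto. apply umbral_ext. intros n _.
      now rewrite RtoC_pow. }
    apply continuous_umbral. intros n _. apply continuous_Cmult; [|apply continuous_const].
    apply rc. auto_derive. apply Rgt_not_eq, Rmult_lt_0_compat; auto.
  - apply rc. auto_derive. auto.
Qed.

Lemma continuous_integrand m b e a c : Re b > Rmax 0 (INR m - 1) -> e < 1 ->
  admissible a c -> forall t, 0 < t < 1 -> continuous (integrand m b e a c) t.
Proof.
  intros hb he h.
  intros t ht. unfold integrand. apply continuous_Cmult; [apply continuous_Cmult|].
    + apply continuous_regular_factor; auto; lra.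
    + apply continuous_Rcpow. lra.
    + eapply is_Cderive_continuous.
      apply (is_Cderive_comp (fun w => Rcpow w (Cminus b (RtoC 1))) (fun t => 1 - t)).
      * apply is_Cderive_Rcpow. lra.
      * auto_derive; auto.
Qed.

Lemma is_RInt_gen_integrand m b e a c : Re b > Rmax 0 (INR m - 1) -> e < 1 -> admissible a c ->
  exists I : C, is_RInt_gen (integrand m b e a c) (at_right 0) (at_left 1) I.
Proof.
  intros hb he h.
  destruct (bounded_on_unit _ (continuous_regular_factor m b e a c hb he h)) as [M [hM HM]].
  assert (b0 := Rmax_l 0 (INR m - 1)). assert (b1 := Rmax_r 0 (INR m - 1)).
  (* Both exponents exceed -1 precisely because Re b > m - 1 and Re b > 0. *)
  apply (ex_RInt_gen_unit _ M (Re b - INR m) (Re b - 1)); auto; try lra.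
  - now apply continuous_integrand.
  - intros t ht. unfold integrand. rewrite !Cmod_mult, !Cmod_Rcpow, exp_plus, <- Rmult_assoc.
    apply Rmult_le_compat; try (left; apply exp_pos).
    + apply Rmult_le_pos; [apply Cmod_ge_0 | left; apply exp_pos].
    + apply Rmult_le_compat; [apply Cmod_ge_0 | left; apply exp_pos | apply HM; lra |].
      apply Req_le. f_equal.
    + apply Req_le. f_equal.
Qed.

Lemma scal_R_Cmult (k : R) (z : C) :
  scal (V := C_R_CompleteNormedModule) k z = Cmult (RtoC k) z.
Proof. apply C_ext; simpl; unfold scal; simpl; unfold mult; simpl; ring. Qed.

(* The sum of the terms at t and at its image, per unit of du. The j-th term of the integrand
   carries root1^(j-1), so for j = 0 the two contributions combine as 1/root1 + 1/root2. *)
Definition folded (b : C) (e a c : R) (j : nat) (u : R) : C :=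
  match j with
  | O => Cmult (RtoC (/ (c - (a + 1) ^ 2))) (beta_integrand b u)
  | S k => Cmult (RtoC (/ ((1 - e) ^ S k * (c - a ^ 2))))
      (Cmult (rodrigues b (S k) u) (RtoC (lucas ((c - a * (a + 1)) / (c - a ^ 2) * (1 - 2 * u))
         (- ((c - (a + 1) ^ 2) / (c - a ^ 2)) * (u * (1 - u))) k)))
  end.

Lemma continuous_folded b e a c j u : 0 < u < 1 -> continuous (folded b e a c j) u.
Proof.
  intros hu. destruct j as [|k]; simpl.
  - apply continuous_Cmult; [apply continuous_const | now apply continuous_beta_integrand].
  - apply continuous_Cmult; [apply continuous_const|]. apply continuous_Cmult.
    + now apply continuous_rodrigues.
    + apply continuous_RtoC, (ex_derive_continuous (V := R_NormedModule)).
      eapply derivative_vanishes_ex_derive, lucas_derivative_vanishes.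
Qed.

Lemma is_RInt_gen_folded b m e a c : Re b > Rmax 0 (INR m - 1) ->
  is_RInt_gen (fun u => umbral m (fun j => folded b e a c j u) (RtoC 1)) (at_right 0) (at_left 1)
    (Cmult (RtoC (/ (c - (a + 1) ^ 2))) (central_beta b)).
Proof.
  intros hb. assert (b0 := Rmax_l 0 (INR m - 1)).
  set (I := fun j => match j with O => Cmult (RtoC (/ (c - (a + 1) ^ 2))) (central_beta b)
    | S _ => RtoC 0 end).
  change (Cmult (RtoC (/ (c - (a + 1) ^ 2))) (central_beta b)) with (I O).
  rewrite <- (umbral_first m I).
  2:{ intros [|n] hn; [lia|reflexivity]. }
  apply is_RInt_gen_umbral. intros [|k] hk; unfold folded, I; cbv iota.
  - apply is_RInt_gen_Cmult, is_RInt_gen_central_beta. lra.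
  - rewrite <- (Cmult_0_r (RtoC (/ ((1 - e) ^ S k * (c - a ^ 2))))).
    apply is_RInt_gen_Cmult. apply (rodrigues_orthogonal b m (S k)); auto.
    (* The factor has degree less than k, while orthogonality to the Rodrigues function of index k +
       1 asks only for degree less than k + 1. *)
    apply derivative_vanishes_succ, lucas_derivative_vanishes.
Qed.

Lemma integrand_fold m b e a c t : Re b > Rmax 0 (INR m - 1) -> admissible a c ->
  e < 1 -> 0 < t < 1 ->
  Cminus (integrand m b e a c t) (Cmult (RtoC (flip' a c t)) (integrand m b e a c (flip a c t))) =
  Cmult (RtoC (uvar' a c t)) (umbral m (fun j => folded b e a c j (uvar a c t)) (RtoC 1)).
Proof.
  intros hb h he ht. assert (ht' : 0 <= t <= 1) by lra.
  assert (hu := uvar_range a c t h ht). assert (hf := flip_range a c t h ht).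
  destruct (roots_pos a c t h ht) as [hr1 hr2].
  assert (hM := fM_pos a c t h ht'). assert (hS := adm_S _ _ h t ht').
  assert (hA := adm_A _ _ h). assert (hK := adm_K _ _ h).
  rewrite !integrand_expand by auto. rewrite root1_flip, uvar_flip by auto.
  set (r1 := root1 a c t) in *. set (r2 := root2 a c t) in *. set (u := uvar a c t) in *.
  set (y := 1 - e). assert (hy : 0 < y) by (unfold y; lra).
  (* Invariance of dt/S: the Jacobian turns 1/S at the image point back into 1/S at t. *)
  assert (ef : - flip' a c t * / (r2 * fS a c (flip a c t)) = / (r2 * fS a c t)).
  { rewrite fS_flip by lra. unfold flip'. field. repeat split; lra. }
  replace (Cminus _ _) with (Cplus
     (Cmult (RtoC (/ (r1 * fS a c t))) (umbral m (fun j => Cmult (RtoC ((r1 / y) ^ j))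
       (rodrigues b j u)) (RtoC 1)))
     (Cmult (RtoC (/ (r2 * fS a c t))) (umbral m (fun j => Cmult (RtoC ((r2 / y) ^ j))
       (rodrigues b j (1 - u))) (RtoC 1)))).
  2:{ rewrite <- ef, RtoC_mult, RtoC_opp. ring. }
  rewrite <- !umbral_scal, <- umbral_plus. apply umbral_ext. intros j hj.
  rewrite (rodrigues_reflect b m j u) by auto.
  replace (Copp (RtoC 1)) with (RtoC (- (1))) by (rewrite RtoC_opp; auto).
  rewrite <- RtoC_pow.
  transitivity (Cmult (RtoC (/ (r1 * fS a c t) * (r1 / y) ^ j + / (r2 * fS a c t) *
    ((r2 / y) ^ j * (- (1)) ^ j)))
     (rodrigues b j u)).
  { rewrite RtoC_plus, !RtoC_mult. ring. }
  assert (hs := root_sum a c t h ht'). assert (hd := root_difference a c t h ht').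
  assert (hp := root_product a c t h ht').
  fold r1 r2 u in hs, hd, hp.
  destruct j as [|k]; unfold folded; cbv iota.
  - unfold rodrigues, beta_integrand. cbn [umbral]. change (INR 0) with 0.
    assert (hw : 0 < u * (1 - u)) by (apply Rmult_lt_0_compat; lra).
    replace (Cminus b (RtoC 0)) with b by ring.
    rewrite Rcpow_minus_1 by auto. set (w := u * (1 - u)) in *.
    assert (j0 : jacobi_coef b 0 = RtoC 1) by (unfold jacobi_coef; cbn [poch Cpow]; field;
    apply RtoC_neq_0; lra).
    rewrite j0.
    assert (nw : RtoC w <> RtoC 0) by (apply RtoC_neq_0; lra).
    replace (/ (r1 * fS a c t) * (r1 / y) ^ 0 + / (r2 * fS a c t) * ((r2 / y) ^ 0 * (- (1)) ^ 0)) with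
      (uvar' a c t * / (c - (a + 1) ^ 2) * / w).
    + rewrite !RtoC_mult, (RtoC_inv w) by lra. field. auto.
    + simpl pow.
      (* The sum of the roots carries du/dt, their product carries u(1 - u); S and c - a^2
         cancel. *)
      transitivity ((r1 + r2) / (r1 * r2 * fS a c t)).
      * rewrite hs, hp. fold w. field. repeat split; lra.
      * field. repeat split; lra.
  - rewrite <- hd.
    replace (- ((c - (a + 1) ^ 2) / (c - a ^ 2)) * (u * (1 - u))) with (r1 * - r2) by
      (transitivity (- (r1 * r2)); [ring | rewrite hp; ring]).
    set (L := lucas (r1 + - r2) (r1 * - r2) k).
    assert (bi := lucas_binet r1 (- r2) k). fold L in bi.
    rewrite Cmult_assoc, (Cmult_comm (rodrigues _ _ _)), Cmult_assoc, <- !RtoC_mult.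
    f_equal. f_equal.
    assert (hyk : 0 < y ^ S k) by now apply pow_lt.
    assert (ed : forall r, (r / y) ^ S k = r ^ S k / y ^ S k).
    { intros r. unfold Rdiv. now rewrite Rpow_mult_distr, pow_inv. }
    rewrite !ed.
    replace (uvar' a c t) with ((r1 + r2) * (c - a ^ 2) / fS a c t) by (rewrite hs; field; lra).
    (* The sign (-1)^(k+1) of the reflection turns the sum of the two contributions into this
       difference, which [lucas_binet] divides by r1 + r2. *)
    transitivity ((r1 ^ k - (- r2) ^ k) / (fS a c t * y ^ S k)).
    + replace (- r2) with (- (1) * r2) by ring. rewrite Rpow_mult_distr.
      set (Y := y ^ S k) in *. cbn [pow].
      generalize (r1 ^ k) (r2 ^ k) ((- (1)) ^ k). intros p1 p2 p3. field. repeat split; lra.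
    + rewrite <- bi. fold y. set (Y := y ^ S k) in *. field. repeat split; lra.
Qed.

Theorem theorem5p2 (m : nat) (beta : C) (e a c : R)
  (hbeta : Re beta > Rmax 0 (INR m - 1))
  (he : e < 1)
  (h1 : forall t, 0 <= t <= 1 -> c - a * (a + t) > 0)
  (h2 : forall t, 0 <= t <= 1 -> c - (a + 1) * (a + t) > 0)
  (h3 : forall t, 0 <= t <= 1 -> c - (a + t) ^ 2 > 0) :
  exists I : C,
    is_RInt_gen
      (fun t : R =>
         Cmult
         (Cmult
         (Cmult
         (Cmult
         (Cdiv (Cmult (Rcpow (c - a * (a + t)) beta)
                      (Rcpow (c - (a + 1) * (a + t)) (Cminus beta (RtoC 1))))
               (Rcpow (c - (a + t) ^ 2) (Cmult (RtoC 2) beta)))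
         (F21_special beta m ((c - (a + t) ^ 2) / ((c - a * (a + t)) * (1 - e * t)))))
         (RtoC (((1 - e * t) / (1 - e)) ^ m)))
         (Rcpow t (Cminus beta (RtoC (INR m)))))
         (Rcpow (1 - t) (Cminus beta (RtoC 1))))
      (at_right 0) (at_left 1) I
    /\ Cdiv (Cmult (CGamma beta) (CGamma beta))
            (Cmult (RtoC 2) (CGamma (Cmult (RtoC 2) beta)))
       = Cmult (RtoC (c - (a + 1) ^ 2)) I.
Proof.
  assert (h := admissible_of a c h1 h2 h3).
  assert (hb : 0 < Re beta) by (assert (k := Rmax_l 0 (INR m - 1)); lra).
  assert (hb2 : 0 < Re (Cmult (RtoC 2) beta)) by (unfold Re in *; simpl; lra).
  (* Convergence comes first, by domination: the folding below only evaluates I + I. *)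
  destruct (is_RInt_gen_integrand m beta e a c hbeta he h) as [I HI].
  exists I. split; [exact HI|].
  destruct (filterlim_uvar a c h) as [lu0 lu1]. destruct (filterlim_flip a c h) as [lf0 lf1].
  assert (Sn : forall t, 0 < t < 1 -> fS a c t <> 0).
  { intros t ht. apply Rgt_not_eq, (adm_S _ _ h). lra. }
  assert (Mn : forall t, 0 < t < 1 -> fM a c t <> 0).
  { intros t ht. apply Rgt_not_eq, fM_pos; auto. lra. }
  (* The involution runs from 1 to 0, so the substitution is applied to the reversed integral. Thus
     [i1] has the value - I, and the difference [i3] has the value 2 I. *)
  assert (i1 := is_RInt_gen_subst (D' := fun x => 0 < x < 1) unit_ends (V := C_R_CompleteNormedModule)
    (integrand m beta e a c) (flip a c) (flip' a c) _
    (fun t ht => flip_range a c t h ht) (continuous_integrand m beta e a c hbeta he h)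
    (fun t ht => is_derive_flip a c t (Mn t ht))
    (fun t ht => ex_derive_continuous (V := R_NormedModule) _ _ (ex_derive_flip' a c t (Mn t ht)))
    lf0 lf1 (is_RInt_gen_swap _ _ HI)).
  assert (i2 := is_RInt_gen_subst (D' := fun x => 0 < x < 1) unit_ends (V := C_R_CompleteNormedModule)
    (fun u => umbral m (fun j => folded beta e a c j u) (RtoC 1)) (uvar a c) (uvar' a c) _
    (fun t ht => uvar_range a c t h ht)
    (fun u hu => continuous_umbral m _ _ u (fun j _ => continuous_folded beta e a c j u hu))
    (fun t ht => is_derive_uvar a c t (Sn t ht))
    (fun t ht => ex_derive_continuous (V := R_NormedModule) _ _ (ex_derive_uvar' a c t (Sn t ht)))
    lu0 lu1 (is_RInt_gen_folded beta m e a c hbeta)).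
  assert (i3 := is_RInt_gen_minus _ _ _ _ HI i1).
  assert (i4 : Cplus I I = Cmult (RtoC (/ (c - (a + 1) ^ 2))) (central_beta beta)).
  { refine (is_RInt_gen_unique_on (V := C_R_CompleteNormedModule) unit_ends _ _ _ _ i2).
    replace (Cplus I I) with (Cplus I (Copp (Copp I))) by ring.
    revert i3. apply (is_RInt_gen_ext_on unit_ends). intros t ht.
    rewrite !scal_R_Cmult. exact (integrand_fold m beta e a c t hbeta h he ht). }
  assert (hK := adm_K _ _ h).
  (* Needed to cancel Gamma(2 beta) once Gamma(beta)^2 is replaced by B(beta,beta) Gamma(2 beta). *)
  assert (g2 := CGamma_neq_0 _ hb2).
  rewrite CGamma_sqr by auto.
  assert (n2 : RtoC 2 <> RtoC 0) by (apply RtoC_neq_0; lra).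
  assert (nK : RtoC (c - (a + 1) ^ 2) <> RtoC 0) by (apply RtoC_neq_0; lra).
  replace I with (Cdiv (Cplus I I) (RtoC 2)).
  2:{ replace (Cplus I I) with (Cmult (RtoC 2) I) by
        (rewrite RtoC_2; ring).
      field. }
  rewrite i4, RtoC_inv by lra. field. auto.
Qed.
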